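(* Let $\mathbb{K}=\mathbb{R}$ or $\mathbb{C}$, let $f:\mathbb{K}^n\to\mathbb{K}^p$ be a polynomial mapping, let $\mathbf{c}\in\mathbb{K}^p$, and define the integer $m$ by requiring that $n-1-m$ be the dimension (over $\mathbb{K}$) of the set $f^{-1}(\mathbf{c})^\infty$ of accumulation points at infinity of the fibre $f^{-1}(\mathbf{c})$. Then $\mathbf{c}$ is a Lipschitz trivial value of $f$ if and only if $$f=g\circ\pi$$ for some linear surjective projection $\pi:\mathbb{K}^n\to\mathbb{K}^m$ and some polynomial mapping $g:\mathbb{K}^m\to\mathbb{K}^p$ for which $\mathbf{c}$ is a regular value of properness.
   Context: A value $\mathbf{c}\in\mathbb{K}^p$ is a Lipschitz trivial value of a mapping $\varphi:\mathbb{K}^n\to\mathbb{K}^p$ if there exist a neighbourhood $\mathcal{V}$ of $\mathbf{c}$ in $\mathbb{K}^p$ and a bi-Lipschitz homeomorphism $H:\varphi^{-1}(\mathbf{c})\times\mathcal{V}\to\varphi^{-1}(\mathcal{V})$ with $(\varphi\circ H)(\mathbf{x},\mathbf{t})=\mathbf{t}$. Here subsets of Euclidean spaces carry the outer metric (the restriction of the ambient Euclidean distance) and products carry the product metric. The empty mapping is allowed, so every value outside the closure of the image of $\varphi$ is Lipschitz trivial. Embed $\mathbb{K}^n$ in $\mathbb{K}\mathbb{P}^n$ by $\mathbf{x}\mapsto[\mathbf{x}:1]$ and let $H_\infty=\mathbb{K}\mathbb{P}^n\setminus\mathbb{K}^n$ be the hyperplane at infinity, consisting of the points $[\mathbf{v}:0]$.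 For $X\subset\mathbb{K}^n$, the accumulation set at infinity is $X^\infty:=\overline{X}\cap H_\infty$, where $\overline X$ is the closure of $X$ in $\mathbb{K}\mathbb{P}^n$. Convention: $\dim\emptyset=-1$. A mapping $g:\mathbb{K}^m\to\mathbb{K}^p$ is proper at $\mathbf{c}$ ($\mathbf{c}$ is a value of properness of $g$) if there is a neighbourhood $\mathcal{V}$ of $\mathbf{c}$ such that the restriction of $g$ to $g^{-1}(\mathcal{V})\to\mathcal{V}$ is proper; empty mappings are proper. The value $\mathbf{c}$ is regular for $g$ if it is not a critical value, i.e. the differential of $g$ is surjective at every point of $g^{-1}(\mathbf{c})$ (vacuously true if this fibre is empty). A regular value of properness is a value that is both regular and a value of properness. *)

(* Defs.v *)
From HB Require Import structures.
From mathcomp Require Import all_boot all_order all_algebra.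
From mathcomp Require Import generic_quotient.
From mathcomp Require Import complex.
From mathcomp.multinomials Require mpoly.
From mathcomp Require Import all_classical all_reals all_analysis.
Set Implicit Arguments.
Unset Strict Implicit.
Unset Printing Implicit Defensive.
Import Order.TTheory GRing.Theory Num.Theory.
Import numFieldNormedType.Exports.
Local Open Scope classical_set_scope.
Local Open Scope quotient_scope.
Local Open Scope ring_scope.

(* [real_or_complex abs] says that K is R or R[i], with its usual absolute
   value [abs] taken in R.  (The norm of R[i] in the library has values in R[i],
   so that R-valued distances are built from [abs].) *)
Variant real_or_complex (R : realType) :
    forall K : numFieldType, (K -> R) -> Prop :=
  | RealScalars : @real_or_complex R R (fun x : R => `|x|)
  | ComplexScalars :
      @real_or_complex R (R[i] : numFieldType) (@ComplexField.Normc.normc R).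

Section Metric.
Variables (R : realType) (K : numFieldType) (abs : K -> R).

Definition eucl_dist n (x y : 'rV[K]_n) : R :=
  Num.sqrt (\sum_(i < n) abs (x 0 i - y 0 i) ^+ 2).

Definition prod_dist n p (u v : 'rV[K]_n * 'rV[K]_p) : R :=
  Num.sqrt (eucl_dist u.1 v.1 ^+ 2 + eucl_dist u.2 v.2 ^+ 2).

Definition bilipschitz_on (T U : Type) (dT : T -> T -> R) (dU : U -> U -> R)
    (A : set T) (h : T -> U) : Prop :=
  exists2 L : R, 0 < L & forall u v, A u -> A v ->
    L^-1 * dT u v <= dU (h u) (h v) <= L * dT u v.

(* The trivialisation H is a total function of which only the restriction to
   the product of the fibre and V matters; being a bi-Lipschitz bijection
   between the two sets, this restriction is a homeomorphism. *)
Definition lipschitz_trivial_value n p (f : 'rV[K]_n -> 'rV[K]_p)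
    (c : 'rV[K]_p) : Prop :=
  exists V : set 'rV[K]_p, nbhs c V /\
  exists H : 'rV[K]_n * 'rV[K]_p -> 'rV[K]_n,
    [/\ set_bij ((f @^-1` [set c]) `*` V) (f @^-1` V) H,
        bilipschitz_on (@prod_dist n p) (@eucl_dist n)
          ((f @^-1` [set c]) `*` V) H
      & forall x t, f x = c -> V t -> f (H (x, t)) = t].

End Metric.

Section ProjectiveSpace.
Variables (K : numFieldType) (n : nat).

Definition nonzero_vec := set_type [set v : 'rV[K]_n.+1 | v != 0].

(* Two nonzero vectors are proportional iff they span the same line. *)
Definition proportional (u v : nonzero_vec) : bool :=
  (set_val u == set_val v)%MS.

Lemma proportional_refl : reflexive proportional.
Proof. by move=> u; rewrite /proportional submx_refl. Qed.

Lemma proportional_sym : symmetric proportional.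
Proof. by move=> u v; rewrite /proportional andbC. Qed.

Lemma proportional_trans : transitive proportional.
Proof.
move=> v u w /andP[uv vu] /andP[vw wv]; apply/andP.
by split; [exact: submx_trans uv vw | exact: submx_trans wv vu].
Qed.

Canonical proportional_equiv :=
  EquivRel proportional proportional_refl proportional_sym proportional_trans.

(* KP^n with the quotient topology *)
Definition projspace : topologicalType :=
  quotient_topology {eq_quot proportional_equiv}.

(* chart i (x_0, .., x_(n-1)) = [x_0 : .. : x_(i-1) : 1 : x_i : .. : x_(n-1)] *)
Definition chart_vec (i : 'I_n.+1) (x : 'rV[K]_n) : 'rV[K]_n.+1 :=
  \row_j (if unlift i j is Some k then x 0 k else 1).

Lemma chart_vec_neq0 i x : chart_vec i x != 0.
Proof.
apply/eqP => /rowP /(_ i); rewrite !mxE unlift_none => /eqP.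
by rewrite oner_eq0.
Qed.

Definition chart (i : 'I_n.+1) (x : 'rV[K]_n) : projspace :=
  \pi_{eq_quot proportional_equiv}
    (exist _ (chart_vec i x) (mem_set (chart_vec_neq0 i x)) : nonzero_vec).

(* x |-> [x : 1] *)
Definition embed : 'rV[K]_n -> projspace := chart ord_max.

Definition hyperplane_infty : set projspace := ~` range embed.

Definition accum_infty (X : set 'rV[K]_n) : set projspace :=
  closure (embed @` X) `&` hyperplane_infty.

(* S contains a d-dimensional C^1 submanifold over K (holomorphic for K = C),
   given by an immersion of a nonempty open subset of K^d read in a chart *)
Definition contains_submanifold (S : set projspace) (d : nat) : Prop :=
  exists (i : 'I_n.+1) (U : set 'rV[K]_d) (phi : 'rV[K]_d -> 'rV[K]_n),
    [/\ open U, U !=set0,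
        forall u, U u ->
          [/\ differentiable phi u, injective ('d phi u)
            & forall v, {for u, continuous (fun u' => 'd phi u' v)}]
      & forall u, U u -> S (chart i (phi u))].

(* The dimension over K of a semialgebraic (K = R) or algebraic (K = C) subset
   of KP^n: the largest dimension of a submanifold that it contains, and -1 for
   the empty set.  The bound d <= n loses nothing, as [contains_submanifold S d]
   provides an injective linear map from K^d to K^n. *)
Definition proj_dim (S : set projspace) : int :=
  (\max_(d < n.+1 | `[< contains_submanifold S d >]) d.+1)%N%:Z - 1.

End ProjectiveSpace.

Section Mappings.
Variable K : numFieldType.

Definition polynomial_mapping n p (f : 'rV[K]_n -> 'rV[K]_p) : Prop :=
  exists P : 'I_p -> mpoly.mpoly n K,
    forall x i, f x 0 i = mpoly.meval (fun j => x 0 j) (P i).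

Definition proper_at m p (g : 'rV[K]_m -> 'rV[K]_p) (c : 'rV[K]_p) : Prop :=
  exists V : set 'rV[K]_p, nbhs c V /\
    forall A, A `<=` V -> compact A -> compact (g @^-1` A).

Definition regular_value m p (g : 'rV[K]_m -> 'rV[K]_p) (c : 'rV[K]_p) : Prop :=
  forall x, g x = c -> forall w, exists v, 'd g x v = w.

End Mappings.

(* Main.v *)
From mathcomp Require Import all_boot all_order all_algebra.
From mathcomp Require Import generic_quotient complex.
From mathcomp.multinomials Require mpoly.
From mathcomp Require Import all_classical all_reals all_analysis.
From mathcomp Require Import ring lra zify.
Require Import Defs.
Import -(notations) mpoly.
Set Implicit Arguments.
Unset Strict Implicit.
Unset Printing Implicit Defensive.
Import Order.TTheory GRing.Theory Num.Theory.
Import numFieldNormedType.Exports.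
Local Open Scope classical_set_scope.
Local Open Scope ring_scope.

(** Write X for the fibre of f over c.

    A Lipschitz trivialisation makes f Lipschitz near X, so f stays bounded on a
    tube of positive radius around X ([tube_bounded]).  Let N be the common
    kernel of the linear forms that are bounded on X.  A polynomial that is
    bounded on a tube around X is invariant under translations by N: this is
    [tube_bounded_invariant], an induction on the degree, where finite
    differences along small vectors play the role of derivatives because they
    are still bounded on a thinner tube.  Hence f = g o pi with pi the projection
    along N, and X is the preimage by pi of a bounded set.  Each point near X
    lies on a Lipschitz section of f that starts on X; these sections keep the
    preimages of small balls by g bounded ([g_proper]) and force the differential
    of g to be onto along the fibre ([g_regular]).  Since X is a cylinder over a
    bounded set, its points at infinity form the projective space of N
    ([proj_dim_accum_infty]), and the target of pi has dimension m.

    Conversely, let f = g o pi with c a regular value of properness of g.  The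
    fibre of g is compact and the differential of g has a bounded Lipschitz right
    inverse B near it ([right_inverse]).  The map (x, s) |-> x + s B(x) is a
    tubular parametrisation, and for small s the value of g at x + s B(x) is
    c + s up to an error that is Lipschitz with a small constant.  So s can be
    solved for from the value t of g, and (x, t) |-> x + s B(x) is a bi-Lipschitz
    trivialisation of g ([proper_trivialisation]); surjectivity is a second fixed
    point argument, in which x and s are unknown ([param_onto_tube]).  Multiplying
    by the identity of the kernel of pi trivialises f
    ([linear_pullback_trivial]). *)

(** * Real and complex scalars *)

(** The features that R and R[i] share and on which the proof rests: the real
    line inside K, a conjugation (for the Gram matrices of the differential) and
    the compactness of discs. *)
Record scalars (R : realType) (K : numFieldType) (abs : K -> R) := Scalars {
  emb : {rmorphism R -> K};
  cj : {rmorphism K -> K};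
  normE : forall x, `|x| = emb (abs x);
  emb_le : {mono emb : a b / a <= b};
  cjE : forall x, x * cj x = `|x| ^+ 2;
  disk_compact : forall r, compact [set x : K | abs x <= r] }.
Existing Class scalars.
Arguments emb {R K abs} S : rename.
Arguments cj {R K abs} S : rename.
Arguments normE {R K abs} {S} x : rename.
Arguments emb_le {R K abs} S : rename.
Arguments cjE {R K abs} {S} x : rename.
Arguments disk_compact {R K abs} {S} r : rename.

(** The disc is closed in the image of the square [-r, r] x [-r, r]. *)
Lemma complex_disk_compact (R : realType) r :
  compact [set x : (R[i] : numFieldType) | ComplexField.Normc.normc x <= r].
Proof.
pose h (u : R * R) : (R[i] : numFieldType) := (u.1 +i* u.2)%C.
pose D := `[- r, r]%classic : set R.
have hE u : h u = (u.1)%:C%C + 'i%C * (u.2)%:C%C by rewrite [LHS]complexE.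
have normC (x : R[i]) : `|x| = (ComplexField.Normc.normc x)%:C%C by [].
have le_normcD (x y : R[i]) : ComplexField.Normc.normc (x + y)
    <= ComplexField.Normc.normc x + ComplexField.Normc.normc y.
  by have := ler_normD x y; rewrite !normC -rmorphD /= lecR.
have h_cont : continuous h.
  move=> u; apply/cvg_ballP => e e0.
  have eE : e = (complex.Re e)%:C%C.
    by apply/esym/RRe_real; rewrite realE (ltW e0).
  have e'0 : 0 < complex.Re e by move: e0; rewrite {1}eE ltcR.
  have e2 : 0 < complex.Re e / 2 by rewrite divr_gt0.
  have := @nbhsx_ballx R (R * R)%type u _ e2.
  apply: filterS => v [] /=; rewrite -!ball_normE /= => uv1 uv2.
  rewrite /ball_ /= eE normC ltcR.
  have -> : h u - h v = (u.1 - v.1)%:C%C + 'i%C * (u.2 - v.2)%:C%C.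
    by rewrite !hE !rmorphB /=; ring.
  apply: le_lt_trans (le_normcD _ _) _.
  rewrite ComplexField.Normc.normcM /ComplexField.Normc.normc /=.
  rewrite !expr0n /= !expr1n !addr0 !add0r sqrtr1 mul1r.
  by rewrite !sqrtr_sqr [ltRHS]splitr ltrD.
have cD : compact (h @` (D `*` D)).
  apply: continuous_compact; last by apply: compact_setX; apply: segment_compact.
  by apply: continuous_subspaceT => u; exact: h_cont.
apply: subclosed_compact cD _.
- rewrite -[X in closed X]setCK closedC openE => x /= /negP; rewrite -ltNge => rx.
  have d0 : 0 < (ComplexField.Normc.normc x - r)%:C%C by rewrite ltcR subr_gt0.
  have := nbhsx_ballx x _ d0.
  apply: filterS => y; rewrite -ball_normE /= normC ltcR => xy.
  apply/negP; rewrite -ltNge.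
  have := le_normcD y (x - y).
  rewrite addrC subrK; lra.
- move=> x /= xr.
  have re : `|complex.Re x| <= r.
    by move: (normc_ge_Re x); rewrite normC lecR => /le_trans; apply.
  have im : `|complex.Im x| <= r.
    have := normc_ge_Re (x * 'i%C); rewrite ReiNIm normrN normC lecR => /le_trans; apply.
    rewrite ComplexField.Normc.normcM [X in _ * X]/ComplexField.Normc.normc /=.
    rewrite !expr0n /= !expr1n add0r sqrtr1 mulr1.
    exact: xr.
  exists (complex.Re x, complex.Im x); last by rewrite /h; case: (x).
  by split; rewrite /D /= in_itv /= -ler_norml.
Qed.

Lemma real_or_complex_scalars (R : realType) (K : numFieldType) (abs : K -> R) :
  real_or_complex abs -> exists S : scalars abs, True.
Proof.
case.
- unshelve eexists; last by [].
  have idc r : compact [set x : R | `|x| <= r].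
    rewrite [X in compact X](_ : _ = `[- r, r]%classic); first exact: segment_compact.
    by apply/seteqP; split => x /=; rewrite in_itv /= ler_norml.
  refine (@Scalars R R (fun x : R => `|x|) idfun idfun _ _ _ idc) => //.
  by move=> x /=; rewrite real_normK ?num_real ?expr2.
- unshelve eexists; last by [].
  refine (@Scalars R _ (@ComplexField.Normc.normc R) (real_complex R) conjc _ _ _ _).
  + by move=> x.
  + by move=> a b; exact: lecR.
  + by move=> x; rewrite sqr_normc.
  + exact: complex_disk_compact.
Qed.

(** * The l1 norm and compactness *)

Section Scalars.
Context (R : realType) (K : numFieldType) (abs : K -> R) {S : scalars abs}.
Implicit Types (x y z : K) (a b : R).

Lemma emb_inj : injective (emb S).
Proof. by move=> a b ab; apply/eqP; rewrite eq_le -!(emb_le S) ab lexx. Qed.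

Lemma emb_lt a b : (emb S a < emb S b) = (a < b).
Proof. by rewrite !lt_def emb_le (inj_eq emb_inj). Qed.

Lemma abs_ge0 x : 0 <= abs x.
Proof. by rewrite -(emb_le S) rmorph0 -normE. Qed.

Lemma abs_emb a : abs (emb S a) = `|a|.
Proof.
apply: emb_inj; rewrite -normE; case: (ger0P a) => a0.
  by rewrite ger0_norm // -(rmorph0 (emb S)) emb_le.
by rewrite rmorphN ltr0_norm // -(rmorph0 (emb S)) emb_lt.
Qed.

Lemma absM x y : abs (x * y) = abs x * abs y.
Proof. by apply: emb_inj; rewrite rmorphM -!normE normrM. Qed.

Lemma absD x y : abs (x + y) <= abs x + abs y.
Proof. by rewrite -(emb_le S) rmorphD -!normE ler_normD. Qed.

Lemma absN x : abs (- x) = abs x.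
Proof. by apply: emb_inj; rewrite -!normE normrN. Qed.

Lemma abs_eq0 x : (abs x == 0) = (x == 0).
Proof. by rewrite -(inj_eq emb_inj) rmorph0 -normE normr_eq0. Qed.

Lemma abs0 : abs 0 = 0.
Proof. by apply/eqP; rewrite abs_eq0. Qed.

Lemma abs1 : abs 1 = 1.
Proof. by rewrite -(rmorph1 (emb S)) abs_emb normr1. Qed.

Lemma absBC x y : abs (x - y) = abs (y - x).
Proof. by rewrite -absN opprB. Qed.

Lemma absV x : abs x^-1 = (abs x)^-1.
Proof.
have [->|x0] := eqVneq x 0; first by rewrite !(invr0, abs0).
have ax0 : abs x != 0 by rewrite abs_eq0.
by apply: (mulfI ax0); rewrite -absM !divff // abs1.
Qed.

Lemma abs_cj x : abs (cj S x) = abs x.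
Proof.
have [->|x0] := eqVneq x 0; first by rewrite rmorph0.
have ax0 : abs x != 0 by rewrite abs_eq0.
apply: (mulfI ax0); rewrite -absM cjE; apply: emb_inj.
by rewrite -normE normrX normr_id rmorphM -normE expr2.
Qed.

Lemma abs_sum (I : Type) (r : seq I) (P : pred I) (F : I -> K) :
  abs (\sum_(i <- r | P i) F i) <= \sum_(i <- r | P i) abs (F i).
Proof.
elim/big_ind2: _ => [|x a y b xa yb|i _] //; first by rewrite abs0.
by apply: le_trans (absD _ _) _; apply: lerD.
Qed.

(** The l1 norm: real valued, submultiplicative, free of square roots, and
    equivalent to the Euclidean norm. *)
Definition nrm m n (A : 'M[K]_(m, n)) : R := \sum_i \sum_j abs (A i j).

Lemma nrm_ge0 m n (A : 'M[K]_(m, n)) : 0 <= nrm A.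
Proof. by apply: sumr_ge0 => i _; apply: sumr_ge0 => j _; apply: abs_ge0. Qed.
Hint Resolve nrm_ge0 abs_ge0 : core.

Lemma abs_le_nrm m n (A : 'M[K]_(m, n)) i j : abs (A i j) <= nrm A.
Proof.
rewrite /nrm (bigD1 i) //= (bigD1 j) //= -addrA lerDl addr_ge0 //.
  by apply: sumr_ge0.
by apply: sumr_ge0 => k _; apply: sumr_ge0.
Qed.

Lemma nrm_row n (v : 'rV[K]_n) : nrm v = \sum_j abs (v 0 j).
Proof. by rewrite /nrm big_ord1. Qed.

Lemma nrm0 m n : nrm (0 : 'M[K]_(m, n)) = 0.
Proof. by rewrite /nrm big1 // => i _; rewrite big1 // => j _; rewrite mxE abs0. Qed.

Lemma nrm_le0 m n (A : 'M[K]_(m, n)) : nrm A <= 0 -> A = 0.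
Proof.
move=> A0; apply/matrixP => i j; rewrite mxE; apply/eqP.
by rewrite -abs_eq0 eq_le abs_ge0 andbT (le_trans (abs_le_nrm A i j)).
Qed.

Lemma nrmN m n (A : 'M[K]_(m, n)) : nrm (- A) = nrm A.
Proof. by apply: eq_bigr => i _; apply: eq_bigr => j _; rewrite mxE absN. Qed.

Lemma nrmBC m n (A B : 'M[K]_(m, n)) : nrm (A - B) = nrm (B - A).
Proof. by rewrite -nrmN opprB. Qed.

Lemma nrmD m n (A B : 'M[K]_(m, n)) : nrm (A + B) <= nrm A + nrm B.
Proof.
rewrite /nrm -big_split /=; apply: ler_sum => i _.
by rewrite -big_split /=; apply: ler_sum => j _; rewrite mxE absD.
Qed.

Lemma nrmB m n (A B : 'M[K]_(m, n)) : nrm (A - B) <= nrm A + nrm B.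
Proof. by rewrite -(nrmN B) nrmD. Qed.

Lemma nrm_triangle m n (A B C : 'M[K]_(m, n)) :
  nrm (A - C) <= nrm (A - B) + nrm (B - C).
Proof. by apply: le_trans (nrmD _ _); rewrite addrA subrK. Qed.

Lemma nrmZ m n x (A : 'M[K]_(m, n)) : nrm (x *: A) = abs x * nrm A.
Proof.
rewrite /nrm mulr_sumr; apply: eq_bigr => i _.
by rewrite mulr_sumr; apply: eq_bigr => j _; rewrite mxE absM.
Qed.

Lemma nrmM m n p (A : 'M[K]_(m, n)) (B : 'M[K]_(n, p)) :
  nrm (A *m B) <= nrm A * nrm B.
Proof.
rewrite /nrm mulr_suml; apply: ler_sum => i _.
rewrite (@le_trans _ _ (\sum_j \sum_k abs (A i j) * abs (B j k))) //.
  rewrite exchange_big /=; apply: ler_sum => k _; rewrite mxE.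
  by apply: le_trans (abs_sum _ _ _) _; apply: ler_sum => j _; rewrite absM.
rewrite mulr_suml; apply: ler_sum => j _; rewrite -mulr_sumr.
rewrite ler_wpM2l //.
by rewrite (bigD1 j) //= lerDl; apply: sumr_ge0 => k _; apply: sumr_ge0.
Qed.

Lemma nrm_row_mx m n (u : 'rV[K]_m) (v : 'rV[K]_n) :
  nrm (row_mx u v) = nrm u + nrm v.
Proof.
rewrite !nrm_row big_split_ord /=; congr (_ + _); apply: eq_bigr => j _.
  by rewrite row_mxEl.
by rewrite row_mxEr.
Qed.

(** A bound e / (m n + 1) on each entry keeps the sum of the m n entries below e. *)
Lemma nbhs_nrm m n (A : 'M[K]_(m, n)) (V : set 'M[K]_(m, n)) :
  nbhs A V <-> exists2 e, 0 < e & forall B, nrm (B - A) < e -> V B.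
Proof.
split.
  move=> /nbhs_ballP[e /= e0 eV]; exists (abs e).
    by rewrite lt_def abs_ge0 abs_eq0 gt_eqF.
  move=> B BA; apply: eV; split => // i j.
  rewrite -ball_normE /= normE -[ltRHS]gtr0_norm // normE emb_lt.
  apply: le_lt_trans BA; rewrite nrmBC.
  by have := abs_le_nrm (A - B) i j; rewrite !mxE.
move=> [e e0 eV]; apply/nbhs_ballP.
pose e' := e / (m * n).+1%:R.
have e'0 : 0 < e' by rewrite divr_gt0 ?ltr0Sn.
exists (emb S e'); first by rewrite /= -(rmorph0 (emb S)) emb_lt.
move=> B [_ AB]; apply: eV.
apply: (@le_lt_trans _ _ (\sum_(i < m) \sum_(j < n) e')).
  apply: ler_sum => i _; apply: ler_sum => j _; apply: ltW.
  have := AB i j; rewrite -ball_normE /= normE emb_lt.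
  by rewrite !mxE absBC.
rewrite !sumr_const !card_ord -mulrnA mulnC -mulr_natr /e' mulrAC.
by rewrite ltr_pdivrMr ?ltr0Sn // ltr_pM2l // ltr_nat.
Qed.

Lemma continuous_nrm m n (A : set 'M[K]_(m, n)) (f : 'M[K]_(m, n) -> R) :
  (forall u e, A u -> 0 < e -> exists2 d, 0 < d &
     forall v, A v -> nrm (v - u) < d -> `|f v - f u| < e) ->
  {within A, continuous f}.
Proof.
move=> fA; apply/subspace_continuousP => u Au.
apply/cvgrPdist_lt => e e0.
have [d d0 dA] := fA u e Au e0.
rewrite near_withinE; apply/nbhs_nrm; exists d => // v vu Av.
by rewrite distrC; apply: dA.
Qed.

Lemma closed_nrm m n (A : set 'M[K]_(m, n)) :
  (forall u, (forall e, 0 < e -> exists2 v, A v & nrm (v - u) < e) -> A u) ->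
  closed A.
Proof.
move=> clA u ucl; apply: clA => e e0.
have [|v [Av vu]] := ucl [set v | nrm (v - u) < e].
  by apply/nbhs_nrm; exists e.
by exists v.
Qed.

Lemma closedP_nrm m n (A : set 'M[K]_(m, n)) :
  closed A ->
  (forall u, (forall e, 0 < e -> exists2 v, A v & nrm (v - u) < e) -> A u).
Proof.
move=> clA u uA; apply: clA => B /nbhs_nrm[e e0 eB].
by have [v Av vu] := uA e e0; exists v; split => //; apply: eB.
Qed.

Lemma nrm_ball_compact n (u : 'rV[K]_n) r : compact [set v | nrm (v - u) <= r].
Proof.
pose r' := r + nrm u.
have cA : compact [set v : 'rV[K]_n | forall i, abs (v ord0 i) <= r'].
  by apply: (@rV_compact _ _ (fun=> [set x | abs x <= r'])) => i; apply: disk_compact.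
apply: subclosed_compact cA _.
  apply: closed_nrm => v vcl /=; apply/ler_addgt0Pr => e /vcl[w /= wr wv].
  by have := nrm_triangle v w u; rewrite (nrmBC v w); lra.
move=> v /= vr i; apply: le_trans (abs_le_nrm v _ i) _.
by have := nrmD (v - u) u; rewrite subrK /r'; lra.
Qed.

Lemma compact_nrm n (A : set 'rV[K]_n) r :
  closed A -> (forall v, A v -> nrm v <= r) -> compact A.
Proof.
move=> clA Ar; have cB := @nrm_ball_compact n 0 r.
apply: subclosed_compact clA cB _.
by move=> v /Ar; rewrite /= subr0.
Qed.

Lemma compact_min n (A : set 'rV[K]_n) (f : 'rV[K]_n -> R) :
  A !=set0 -> compact A ->
  (forall u e, A u -> 0 < e -> exists2 d, 0 < d &
     forall v, A v -> nrm (v - u) < d -> `|f v - f u| < e) ->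
  exists2 u, A u & forall v, A v -> f u <= f v.
Proof.
move=> A0 cA fA.
have [u uA fu] := compact_EVT_min A0 cA (continuous_nrm fA).
exists u; first by rewrite inE in uA.
by move=> v Av; apply: fu; rewrite inE.
Qed.

Lemma compact_nrm_bounded n (A : set 'rV[K]_n) :
  compact A -> exists2 r, 0 < r & forall v, A v -> nrm v <= r.
Proof.
move=> cA; have [A0|A0] := pselect (A !=set0); last first.
  by exists 1 => // v Av; case: A0; exists v.
have [|u Au umax] := compact_min (f := fun v => - nrm v) A0 cA.
  move=> u e _ e0; exists e => // v _ vu; rewrite ltr_norml.
  have := nrmD (v - u) u; have := nrmD (u - v) v; rewrite !subrK (nrmBC u v).
  lra.
exists (nrm u + 1); first by have := nrm_ge0 u; lra.
by move=> v /umax; lra.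
Qed.

Lemma compact_closed_nrm n (A : set 'rV[K]_n) : compact A -> closed A.
Proof. by apply: compact_closed; apply: norm_hausdorff. Qed.

(** The displacement |T u - u| attains its minimum on the compact ball, which T
    preserves; since T halves displacements, the minimum is 0. *)
Lemma contraction_fixpoint n (T : 'rV[K]_n -> 'rV[K]_n) (a : 'rV[K]_n) (r : R) :
  0 < r ->
  (forall u v, nrm (u - a) <= r -> nrm (v - a) <= r ->
     nrm (T u - T v) <= nrm (u - v) / 2) ->
  nrm (T a - a) <= r / 2 ->
  exists2 u, nrm (u - a) <= r & T u = u.
Proof.
move=> r0 Tc Ta.
have aa : nrm (a - a) <= r by rewrite subrr nrm0 ltW.
have TA u : nrm (u - a) <= r -> nrm (T u - a) <= r.
  by move=> ur; have := Tc u a ur aa; have := nrm_triangle (T u) (T a) a; lra.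
have [||u ur umin] := compact_min (f := fun u => nrm (T u - u)) _ (@nrm_ball_compact n a r).
- by exists a.
- move=> u e /= ur e0; exists (e / 2); first by lra.
  move=> v /= vr vu; rewrite ltr_norml.
  have := Tc u v ur vr; have := nrm_triangle (T u) (T v) u.
  have := nrm_triangle (T v) v u; have := nrm_triangle (T v) (T u) v.
  have := nrm_triangle (T u) u v.
  by rewrite (nrmBC (T v) (T u)) (nrmBC u v); lra.
exists u => //; apply/eqP; rewrite -subr_eq0; apply/eqP/nrm_le0.
have := umin _ (TA u ur); have := Tc _ _ (TA u ur) ur.
lra.
Qed.

End Scalars.

(** * Bounded Lipschitz maps and polynomial functions *)

Section BoundedLipschitz.
Context (R : realType) (K : numFieldType) (abs : K -> R) {S : scalars abs}.
Let nrm_pos m n (A : 'M[K]_(m, n)) : 0 <= nrm abs A.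
Proof. exact: nrm_ge0. Qed.
Let abs_pos (x : K) : 0 <= abs x.
Proof. exact: abs_ge0. Qed.
Hint Resolve nrm_pos abs_pos : core.

Section OneDomain.
Variables (T : Type) (d : T -> T -> R) (D : set T).
Hypothesis d_ge0 : forall u v, 0 <= d u v.

(** Bounded and Lipschitz on D.  Boundedness is required because it makes the
    class stable under products; stability under sums, products and inverses
    bounded away from 0 gives all the Lipschitz estimates below. *)
Definition blip m n (A : T -> 'M[K]_(m, n)) := exists2 C, 0 < C &
  forall u v, D u -> D v ->
    nrm abs (A u) <= C /\ nrm abs (A u - A v) <= C * d u v.

(** The same for scalar functions, needed for determinants and inverses. *)
Definition blip1 (f : T -> K) := exists2 C, 0 < C &
  forall u v, D u -> D v -> abs (f u) <= C /\ abs (f u - f v) <= C * d u v.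

Lemma blip1_entry m n (A : T -> 'M[K]_(m, n)) i j :
  blip A -> blip1 (fun u => A u i j).
Proof.
move=> [C C0 AC]; exists C => // u v Du Dv; have [Au Auv] := AC u v Du Dv.
split; first by apply: le_trans Au; apply: abs_le_nrm.
apply: le_trans Auv; have := abs_le_nrm (S := S) (A u - A v) i j.
by rewrite !mxE.
Qed.

Lemma blip1_cst c : blip1 (fun=> c).
Proof.
exists (abs c + 1) => [|u v _ _]; first by have := abs_pos c; lra.
rewrite subrr (abs0 (abs := abs)); split; first lra.
by rewrite mulr_ge0 // addr_ge0.
Qed.

Lemma blip1D f g : blip1 f -> blip1 g -> blip1 (fun u => f u + g u).
Proof.
move=> [C C0 fC] [E E0 gE]; exists (C + E) => [|u v Du Dv]; first lra.
have [fu fuv] := fC u v Du Dv; have [gu guv] := gE u v Du Dv.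
have := absD (S := S) (f u) (g u); split; first lra.
rewrite opprD addrACA mulrDl.
by have := absD (S := S) (f u - f v) (g u - g v); lra.
Qed.

Lemma blip1M f g : blip1 f -> blip1 g -> blip1 (fun u => f u * g u).
Proof.
move=> [C C0 fC] [E E0 gE]; exists (C * E + C * E) => [|u v Du Dv].
  by rewrite addr_gt0 // mulr_gt0.
have [fu fuv] := fC u v Du Dv; have [gu guv] := gE u v Du Dv.
have [fv _] := fC v u Dv Du.
split; first by rewrite absM; apply: ler_wpDr; [by rewrite mulr_ge0 // ltW | exact: ler_pM].
have -> : f u * g u - f v * g v = (f u - f v) * g u + f v * (g u - g v) by ring.
apply: le_trans (absD _ _) _; rewrite !absM mulrDl; apply: lerD.
  by rewrite mulrAC; apply: ler_pM.
by rewrite -mulrA; apply: ler_pM.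
Qed.

Lemma blip1V f e : 0 < e -> (forall u, D u -> e <= abs (f u)) ->
  blip1 f -> blip1 (fun u => (f u)^-1).
Proof.
move=> e0 fe [C C0 fC].
have e1 : 0 < e^-1 by rewrite invr_gt0.
exists (e^-1 + e^-1 * C * e^-1) => [|u v Du Dv].
  by rewrite addr_gt0 // !mulr_gt0.
have [_ fuv] := fC v u Dv Du.
have Ve w : D w -> abs (f w)^-1 <= e^-1.
  by move=> Dw; rewrite absV lef_pV2 ?posrE ?fe // (lt_le_trans e0) ?fe.
have f0 w : D w -> f w != 0.
  by move=> /fe; rewrite -(abs_eq0 (abs := abs)) => ?; rewrite gt_eqF // (lt_le_trans e0).
split; first by rewrite ler_wpDr ?Ve // !mulr_ge0 // ltW.
have -> : (f u)^-1 - (f v)^-1 = (f u)^-1 * (f v - f u) * (f v)^-1.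
  by rewrite mulrBr mulrBl mulfK ?f0 // mulVf ?f0 // mul1r.
have duv : 0 <= e^-1 * d u v by rewrite mulr_ge0 // ltW.
rewrite mulrDl -[leLHS]add0r lerD // !absM (mulrAC _ _ (d u v)).
apply: ler_pM; rewrite ?mulr_ge0 ?Ve //.
rewrite -mulrA; apply: ler_pM; rewrite ?Ve //.
by have [] := fC u v Du Dv; rewrite absBC.
Qed.

Lemma blip1_sum (I : Type) (r : seq I) (P : pred I) (F : I -> T -> K) :
  (forall i, blip1 (F i)) -> blip1 (fun u => \sum_(i <- r | P i) F i u).
Proof.
move=> FB; elim: r => [|i r IH].
  by under [fun u => _]eq_fun do rewrite big_nil; exact: blip1_cst.
under [fun u => _]eq_fun do rewrite big_cons.
by case: (P i); [apply: blip1D|].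
Qed.

Lemma blip1_prod (I : Type) (r : seq I) (P : pred I) (F : I -> T -> K) :
  (forall i, blip1 (F i)) -> blip1 (fun u => \prod_(i <- r | P i) F i u).
Proof.
move=> FB; elim: r => [|i r IH].
  by under [fun u => _]eq_fun do rewrite big_nil; exact: blip1_cst.
under [fun u => _]eq_fun do rewrite big_cons.
by case: (P i); [apply: blip1M|].
Qed.

Lemma blip1_cj f : blip1 f -> blip1 (fun u => cj S (f u)).
Proof.
move=> [C C0 fC]; exists C => // u v Du Dv.
by rewrite -rmorphB !abs_cj; apply: fC.
Qed.

Lemma blip_cst m n (A : 'M[K]_(m, n)) : blip (fun=> A).
Proof.
exists (nrm abs A + 1) => [|u v _ _]; first by have := nrm_pos A; lra.
rewrite subrr nrm0; split; first lra.
by rewrite mulr_ge0 // addr_ge0.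
Qed.

Lemma blipD m n (A B : T -> 'M[K]_(m, n)) :
  blip A -> blip B -> blip (fun u => A u + B u).
Proof.
move=> [C C0 fC] [E E0 gE]; exists (C + E) => [|u v Du Dv]; first lra.
have [fu fuv] := fC u v Du Dv; have [gu guv] := gE u v Du Dv.
have := nrmD (S := S) (A u) (B u); split; first lra.
rewrite opprD addrACA mulrDl.
by have := nrmD (S := S) (A u - A v) (B u - B v); lra.
Qed.

Lemma blipN m n (A : T -> 'M[K]_(m, n)) : blip A -> blip (fun u => - A u).
Proof.
move=> [C C0 AC]; exists C => // u v Du Dv.
by rewrite -opprD !nrmN; apply: AC.
Qed.

Lemma blipB m n (A B : T -> 'M[K]_(m, n)) :
  blip A -> blip B -> blip (fun u => A u - B u).
Proof. by move=> AB BB; apply: blipD => //; apply: blipN. Qed.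

Lemma blipM m n p (A : T -> 'M[K]_(m, n)) (B : T -> 'M[K]_(n, p)) :
  blip A -> blip B -> blip (fun u => A u *m B u).
Proof.
move=> [C C0 fC] [E E0 gE]; exists (C * E + C * E) => [|u v Du Dv].
  by rewrite addr_gt0 // mulr_gt0.
have [fu fuv] := fC u v Du Dv; have [gu guv] := gE u v Du Dv.
have [fv _] := fC v u Dv Du.
split.
  apply: le_trans (nrmM _ _) _; apply: ler_wpDr; first by rewrite mulr_ge0 // ltW.
  by apply: ler_pM.
have -> : A u *m B u - A v *m B v = (A u - A v) *m B u + A v *m (B u - B v).
  by rewrite mulmxBl mulmxBr addrA subrK.
apply: le_trans (nrmD _ _) _; rewrite mulrDl; apply: lerD.
  by apply: le_trans (nrmM _ _) _; rewrite mulrAC; apply: ler_pM.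
by apply: le_trans (nrmM _ _) _; rewrite -mulrA; apply: ler_pM.
Qed.

Lemma blip_entries m n (A : T -> 'M[K]_(m, n)) :
  (forall i j, blip1 (fun u => A u i j)) -> blip A.
Proof.
move=> AB.
have AE : A = fun u => \sum_i \sum_j A u i j *: delta_mx i j.
  by apply/funext => u; exact: matrix_sum_delta.
have sumB (I : finType) (F : I -> T -> 'M[K]_(m, n)) :
    (forall i, blip (F i)) -> blip (fun u => \sum_i F i u).
  move=> FB; elim: (index_enum I) => [|i r IH].
    by under [fun u => _]eq_fun do rewrite big_nil; exact: blip_cst.
  by under [fun u => _]eq_fun do rewrite big_cons; exact: blipD.
rewrite AE; apply: (sumB _ (fun i u => _)) => i; apply: (sumB _ (fun j u => _)) => j.
have [C C0 AC] := AB i j.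
have dE : nrm abs (delta_mx i j : 'M[K]_(m, n)) = 1.
  rewrite /nrm (bigD1 i) //= (bigD1 j) //= mxE !eqxx abs1 !big1 ?addr0 //.
    move=> k ki; apply: big1 => l _.
    by rewrite mxE (negbTE ki) abs0.
  by move=> k kj; rewrite mxE (negbTE kj) andbF abs0.
exists C => // u v Du Dv; rewrite -scalerBl !nrmZ dE !mulr1.
exact: AC.
Qed.

Lemma blipZ m n f (A : T -> 'M[K]_(m, n)) :
  blip1 f -> blip A -> blip (fun u => f u *: A u).
Proof.
move=> fB AB; apply: blip_entries => i j.
under [fun u => _]eq_fun do rewrite mxE.
by apply: blip1M => //; apply: blip1_entry.
Qed.

Lemma blip1_det n (A : T -> 'M[K]_n) : blip A -> blip1 (fun u => \det (A u)).
Proof.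
move=> AB; rewrite /determinant.
apply: (blip1_sum _ _ (F := fun s u => _)) => s.
apply: blip1M; first exact: blip1_cst.
by apply: (blip1_prod _ _ (F := fun i u => _)) => i; apply: blip1_entry.
Qed.

Lemma blip_adj n (A : T -> 'M[K]_n) : blip A -> blip (fun u => \adj (A u)).
Proof.
move=> AB; apply: blip_entries => i j.
under [fun u => _]eq_fun do rewrite mxE /cofactor.
apply: blip1M; first exact: blip1_cst.
apply: blip1_det; apply: blip_entries => k l.
under [fun u => _]eq_fun do rewrite !mxE.
exact: blip1_entry.
Qed.

Lemma blip_adjoint m n (A : T -> 'M[K]_(m, n)) :
  blip A -> blip (fun u => (map_mx (cj S) (A u))^T).
Proof.
move=> AB; apply: blip_entries => i j.
under [fun u => _]eq_fun do rewrite !mxE.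
by apply: blip1_cj; apply: blip1_entry.
Qed.

End OneDomain.

Lemma blip_comp (T U : Type) (d : T -> T -> R) (e : U -> U -> R)
    (D : set T) (E : set U) (h : T -> U) c m n (A : U -> 'M[K]_(m, n)) :
  0 < c -> (forall u, D u -> E (h u)) ->
  (forall u v, 0 <= d u v) ->
  (forall u v, D u -> D v -> e (h u) (h v) <= c * d u v) ->
  blip e E A -> blip d D (A \o h).
Proof.
move=> c0 DE d0 hc [C C0 AC]; exists (C + C * c) => [|u v Du Dv].
  by rewrite addr_gt0 // mulr_gt0.
have [Au Auv] := AC _ _ (DE u Du) (DE v Dv).
split; first by rewrite ler_wpDr // ltW // mulr_gt0.
apply: le_trans Auv _; rewrite mulrDl -[leLHS]add0r lerD //.
  by rewrite mulr_ge0 // ltW.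
by rewrite -mulrA ler_pM2l // hc.
Qed.

Lemma blip1_comp (T U : Type) (d : T -> T -> R) (e : U -> U -> R)
    (D : set T) (E : set U) (h : T -> U) (f : U -> K) :
  (forall u, D u -> E (h u)) ->
  (forall u v, D u -> D v -> e (h u) (h v) <= d u v) ->
  blip1 e E f -> blip1 d D (f \o h).
Proof.
move=> DE hc [C C0 fC]; exists C => // u v Du Dv.
have [fu fuv] := fC _ _ (DE u Du) (DE v Dv); split => //.
by apply: le_trans fuv _; rewrite ler_pM2l // hc.
Qed.

Lemma blip_sub (T : Type) (d : T -> T -> R) (D E : set T) m n
    (A : T -> 'M[K]_(m, n)) : D `<=` E -> blip d E A -> blip d D A.
Proof.
move=> DE [C C0 AC]; exists C => // u v Du Dv.
by apply: AC; apply: DE.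
Qed.

End BoundedLipschitz.

Section Polynomials.
Context (R : realType) (K : numFieldType) (abs : K -> R) {S : scalars abs}.
Let nrm_pos m n (A : 'M[K]_(m, n)) : 0 <= nrm abs A.
Proof. exact: nrm_ge0. Qed.
Let abs_pos (x : K) : 0 <= abs x.
Proof. exact: abs_ge0. Qed.
Hint Resolve nrm_pos abs_pos : core.

(** Polynomial functions as the closure of constants and coordinates under sums
    and products, so that their properties follow by induction. *)
Inductive polyfun n : ('rV[K]_n -> K) -> Prop :=
| polyfun_cst c : polyfun (fun=> c)
| polyfun_coord i : polyfun (fun x => x 0 i)
| polyfunD f g : polyfun f -> polyfun g -> polyfun (fun x => f x + g x)
| polyfunM f g : polyfun f -> polyfun g -> polyfun (fun x => f x * g x).

Definition dist1 n (x y : 'rV[K]_n) : R := nrm abs (x - y).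

Definition dist2 m n (u v : 'rV[K]_m * 'rV[K]_n) : R :=
  nrm abs (u.1 - v.1) + nrm abs (u.2 - v.2).

Lemma dist1_ge0 n (x y : 'rV[K]_n) : 0 <= dist1 x y.
Proof. exact: nrm_ge0. Qed.

Lemma dist2_ge0 m n (u v : 'rV[K]_m * 'rV[K]_n) : 0 <= dist2 u v.
Proof. exact: addr_ge0. Qed.

Definition nball n r : set 'rV[K]_n := [set x | nrm abs x <= r].

Lemma blip_id n r : 0 < r -> blip abs (@dist1 n) (@nball n r) id.
Proof.
move=> r0; exists (r + 1) => [|u v ur vr]; first lra.
split; first by move: ur; rewrite /nball /=; lra.
by rewrite ler_peMl // lerDr ltW.
Qed.

Lemma polyfun_blip n (f : 'rV[K]_n -> K) r : 0 < r -> polyfun f ->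
  blip1 abs (@dist1 n) (@nball n r) f.
Proof.
move=> r0; elim => [c|i|g h _ gB _ hB|g h _ gB _ hB].
- exact/blip1_cst/dist1_ge0.
- exact/blip1_entry/blip_id.
- exact: blip1D.
- by apply: blip1M => //; apply: dist1_ge0.
Qed.

(** By induction on f, with the Leibniz rule for products.  The quotient D is
    polynomial too, hence bounded and Lipschitz on bounded sets, which takes the
    place of second-order Taylor estimates. *)
Lemma hadamard1 n (f : 'rV[K]_n -> K) : polyfun f ->
  exists D : 'rV[K]_n * 'rV[K]_n -> 'cV[K]_n,
    (forall y z, f y - f z = ((y - z) *m D (y, z)) 0 0) /\
    forall r, 0 < r -> blip abs (@dist2 n n) (@nball n r `*` @nball n r) D.
Proof.
have d0 := @dist2_ge0 n n.
elim=> [c|i|g h _ [Dg [gE gB]] _ [Dh [hE hB]]|g h gp [Dg [gE gB]] hp [Dh [hE hB]]].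
- exists (fun=> 0); split=> [y z|r r0]; first by rewrite subrr mulmx0 mxE.
  exact: blip_cst.
- exists (fun=> delta_mx i 0); split=> [y z|r r0]; last exact: blip_cst.
  by rewrite -colE !mxE.
- exists (fun u => Dg u + Dh u); split=> [y z|r r0].
    by rewrite /= opprD addrACA gE hE mulmxDr [RHS]mxE.
  apply: blipD; [apply: gB|apply: hB]; done.
- exists (fun u => h u.1 *: Dg u + g u.2 *: Dh u); split=> [y z|r r0].
    rewrite /= mulmxDr -!scalemxAr [RHS]mxE [X in _ = X + _]mxE [X in _ = _ + X]mxE -gE -hE.
    by ring.
  have hB1 : blip1 abs (@dist2 n n) (@nball n r `*` @nball n r) (h \o fst).
    apply: blip1_comp (polyfun_blip r0 hp) => [u [] //|u v _ _].
    by rewrite lerDl.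
  have gB1 : blip1 abs (@dist2 n n) (@nball n r `*` @nball n r) (g \o snd).
    apply: blip1_comp (polyfun_blip r0 gp) => [u [] //|u v _ _].
    by rewrite lerDr.
  apply: blipD; apply: blipZ => //; by [exact: gB|exact: hB].
Qed.

Definition polymap n p (g : 'rV[K]_n -> 'rV[K]_p) :=
  forall i, polyfun (fun x => g x 0 i).

Lemma hadamard n p (g : 'rV[K]_n -> 'rV[K]_p) : polymap g ->
  exists2 D : 'rV[K]_n * 'rV[K]_n -> 'M[K]_(n, p),
    forall y z, g y - g z = (y - z) *m D (y, z) &
    forall r, 0 < r -> blip abs (@dist2 n n) (@nball n r `*` @nball n r) D.
Proof.
move=> gp; have [D DP] := choice (fun i => hadamard1 (gp i)).
exists (fun u => \matrix_(k, j) D j u k 0) => [y z|r r0].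
  apply/rowP => j; have [/(_ y z) + _] := DP j; rewrite !mxE => ->.
  by apply: eq_bigr => k _; rewrite !mxE.
apply: blip_entries => [|k j]; first exact: dist2_ge0.
under [fun u => _]eq_fun do rewrite mxE.
by have [_ /(_ r r0)] := DP j; exact: blip1_entry.
Qed.

Lemma polymap_blip n p (g : 'rV[K]_n -> 'rV[K]_p) r : 0 < r -> polymap g ->
  blip abs (@dist1 n) (@nball n r) g.
Proof.
move=> r0 gp; apply: blip_entries => [|i j]; first exact: dist1_ge0.
by rewrite (ord1 i); apply: polyfun_blip.
Qed.

Lemma polyfun_sum n (I : Type) (r : seq I) (F : I -> 'rV[K]_n -> K) :
  (forall i, polyfun (F i)) -> polyfun (fun x => \sum_(i <- r) F i x).
Proof.
move=> FP; elim: r => [|i r IH].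
  by under [fun u => _]eq_fun do rewrite big_nil; exact: polyfun_cst.
by under [fun u => _]eq_fun do rewrite big_cons; exact: polyfunD.
Qed.

Lemma polyfun_prod n (I : Type) (r : seq I) (F : I -> 'rV[K]_n -> K) :
  (forall i, polyfun (F i)) -> polyfun (fun x => \prod_(i <- r) F i x).
Proof.
move=> FP; elim: r => [|i r IH].
  by under [fun u => _]eq_fun do rewrite big_nil; exact: polyfun_cst.
by under [fun u => _]eq_fun do rewrite big_cons; exact: polyfunM.
Qed.

Lemma polyfunX n (f : 'rV[K]_n -> K) k : polyfun f -> polyfun (fun x => f x ^+ k).
Proof.
move=> fp; elim: k => [|k IH].
  by under [fun u => _]eq_fun do rewrite expr0; exact: polyfun_cst.
by under [fun u => _]eq_fun do rewrite exprS; exact: polyfunM.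
Qed.

(** Monomials are products of coordinates, so both descriptions agree. *)
Lemma polyfunP n (f : 'rV[K]_n -> K) :
  polyfun f <->
  exists P : mpoly.mpoly n K, forall x, f x = mpoly.meval (fun j => x 0 j) P.
Proof.
split.
  elim=> [c|i|g h _ [P PE] _ [Q QE]|g h _ [P PE] _ [Q QE]].
  - by exists (mpoly.mpolyC n c) => x; rewrite mpoly.mevalC.
  - by exists (mpoly.mpolyX K (mpoly.mnm1 i)) => x; rewrite mpoly.mevalXU.
  - by exists (P + Q) => x; rewrite mpoly.mevalD PE QE.
  - by exists (P * Q) => x; rewrite mpoly.mevalM PE QE.
move=> [P PE]; under [f]eq_fun do rewrite PE mpoly.mevalE.
apply: polyfun_sum => m; apply: polyfunM; first exact: polyfun_cst.
by apply: polyfun_prod => i; apply/polyfunX/polyfun_coord.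
Qed.

Lemma polymapP n p (g : 'rV[K]_n -> 'rV[K]_p) :
  polymap g <-> polynomial_mapping g.
Proof.
split.
  move=> gp; have [P PE] := choice (fun i => (polyfunP _).1 (gp i)).
  by exists P => x i; rewrite PE.
by move=> [P PE] i; apply/polyfunP; exists (P i) => x.
Qed.

Lemma polyfun_affine m n (f : 'rV[K]_n -> K) (A : 'M[K]_(m, n)) (b : 'rV[K]_n) :
  polyfun f -> polyfun (fun x => f (x *m A + b)).
Proof.
elim=> [c|j|g h _ gP _ hP|g h _ gP _ hP].
- exact: polyfun_cst.
- under [fun u => _]eq_fun do rewrite !mxE.
  apply: polyfunD; last exact: polyfun_cst.
  by apply: polyfun_sum => k; apply: polyfunM;
    [exact: polyfun_coord|exact: polyfun_cst].
- exact: polyfunD.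
- exact: polyfunM.
Qed.

End Polynomials.

(** * Differentials *)

Section Differentials.
Context (R : realType) (K : numFieldType) (abs : K -> R) {S : scalars abs}.
Let nrm_pos m n (A : 'M[K]_(m, n)) : 0 <= nrm abs A.
Proof. exact: nrm_ge0. Qed.
Let abs_pos (x : K) : 0 <= abs x.
Proof. exact: abs_ge0. Qed.
Hint Resolve nrm_pos abs_pos : core.

Lemma emb_gt0 a : (0 < emb S a) = (0 < a).
Proof. by rewrite -(rmorph0 (emb S)) emb_lt. Qed.

Lemma pos_embP (e : K) : 0 < e -> exists2 a, 0 < a & e = emb S a.
Proof.
move=> e0; exists (abs e); last by rewrite -normE gtr0_norm.
by rewrite -emb_gt0 -normE normr_gt0 gt_eqF.
Qed.

Lemma norm_le_nrm m n (A : 'M[K]_(m, n)) : `|A| <= emb S (nrm abs A).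
Proof.
have [A0|A0] := eqVneq (mx_norm A) 0.
  by rewrite [leLHS]A0 -(rmorph0 (emb S)) emb_le.
have [i Ai] := mx_norm_neq0 A0.
by rewrite [leLHS]Ai normE emb_le abs_le_nrm.
Qed.

Lemma nrm_le_norm m n (A : 'M[K]_(m, n)) :
  emb S (nrm abs A) <= `|A| * (m * n)%:R.
Proof.
have Aij i j : emb S (abs (A i j)) <= `|A|.
  rewrite -normE -[leRHS]/(mx_norm A) mx_normE -[leLHS]nngE num_le.
  exact: (le_bigmax _ (fun ij => `|A ij.1 ij.2|%:nng) (i, j)).
rewrite /nrm rmorph_sum /=.
apply: (@le_trans _ _ (\sum_(i < m) \sum_(j < n) `|A|)).
  by apply: ler_sum => i _; rewrite rmorph_sum; apply: ler_sum => j _.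
by rewrite !sumr_const !card_ord -mulrnA mulnC mulr_natr.
Qed.

Lemma mulmxr_continuous m p (J : 'M[K]_(m, p)) :
  continuous (mulmxr J : 'rV[K]_m -> 'rV[K]_p).
Proof.
move=> u; apply/(@cvgrPdist_lt _ _ _ (nbhs u)) => _ /pos_embP[e e0 ->].
apply/nbhs_nrm; exists (e / (nrm abs J + 1)).
  by rewrite divr_gt0 // ltr_wpDl.
move=> w wu; apply: le_lt_trans (norm_le_nrm _) _; rewrite emb_lt /=.
rewrite -mulmxBl; apply: le_lt_trans (nrmM _ _) _; rewrite nrmBC.
apply: (@le_lt_trans _ _ (nrm abs (w - u) * (nrm abs J + 1))).
  by rewrite ler_wpM2l // lerDl.
by rewrite -ltr_pdivlMr // ltr_wpDl.
Qed.

Lemma diff_nrm m p (g : 'rV[K]_m -> 'rV[K]_p) (J : 'M[K]_(m, p)) x :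
  (forall e, 0 < e -> exists2 d, 0 < d & forall h, nrm abs h < d ->
     nrm abs (g (x + h) - g x - h *m J) <= e * nrm abs h) ->
  forall v, 'd g x v = v *m J.
Proof.
move=> gJ v.
rewrite (@diff_unique _ _ _ g (mulmxr J)) //.
  exact: mulmxr_continuous.
apply/eqaddoP => _ /pos_embP[e e0 ->].
pose e' := e / (1 * m).+1%:R.
have e'0 : 0 < e' by rewrite divr_gt0 // ltr0Sn.
have [d d0 dJ] := gJ e' e'0.
apply/nbhs_nrm; exists d => // h; rewrite subr0 => /dJ hJ.
have -> : (g \o shift x - (cst (g x) + mulmxr J)) h = g (x + h) - g x - h *m J.
  by rewrite !fctE /= opprD addrA (addrC h).
apply: le_trans (norm_le_nrm _) _.
have : emb S e' * emb S (nrm abs h) <= emb S e * `|h|.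
  apply: (@le_trans _ _ (emb S e' * (`|h| * (1 * m)%:R))).
    by rewrite ler_wpM2l ?nrm_le_norm // ltW // emb_gt0.
  rewrite mulrA mulrAC ler_wpM2r // -(rmorph_nat (emb S)) -rmorphM emb_le.
  by rewrite /e' mulrAC ler_pdivrMr ?ltr0Sn // ler_pM2l // ler_nat.
by apply: le_trans; rewrite -rmorphM emb_le.
Qed.

Lemma differentiable_nrm m p (g : 'rV[K]_m -> 'rV[K]_p) x e :
  differentiable g x -> 0 < e ->
  exists2 d, 0 < d & forall h, nrm abs h < d ->
     nrm abs (g (x + h) - g x - 'd g x h) <= e * nrm abs h.
Proof.
move=> /diff_locally /eqaddoP gx e0.
pose e' := e / (1 * p).+1%:R.
have e'0 : 0 < e' by rewrite divr_gt0 // ltr0Sn.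
have /gx /nbhs_nrm[d d0 dg] : 0 < emb S e' by rewrite emb_gt0.
exists d => // h hd; have := dg h; rewrite subr0 => /(_ hd).
have -> : (g \o shift x - (cst (g x) + 'd g x)) h = g (x + h) - g x - 'd g x h.
  by rewrite !fctE /= opprD addrA (addrC h).
move=> hJ; rewrite -(emb_le S).
apply: le_trans (nrm_le_norm _) _.
apply: (@le_trans _ _ (emb S e' * `|h| * (1 * p)%:R)).
  by rewrite ler_wpM2r // ler0n.
apply: (@le_trans _ _ (emb S e * `|h|)).
  rewrite mulrAC ler_wpM2r // -(rmorph_nat (emb S)) -rmorphM emb_le.
  by rewrite /e' mulrAC ler_pdivrMr ?ltr0Sn // ler_pM2l // ler_nat.
rewrite rmorphM ler_wpM2l ?norm_le_nrm // ltW // emb_gt0 //.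
Qed.

(** On the diagonal the difference quotient is the Jacobian matrix, because D is
    Lipschitz; differentials act on row vectors from the right. *)
Lemma diff_hadamard m p (g : 'rV[K]_m -> 'rV[K]_p) D :
  (forall y z, g y - g z = (y - z) *m D (y, z)) ->
  (forall r, 0 < r ->
     blip abs (@dist2 _ _ abs m m) (@nball _ _ abs m r `*` @nball _ _ abs m r) D) ->
  forall x v, 'd g x v = v *m D (x, x).
Proof.
move=> gD DB x; apply: diff_nrm => e e0.
have [|C C0 DC] := DB (nrm abs x + 1); first by rewrite ltr_wpDl.
exists (Num.min 1 (e / C)); first by rewrite lt_min ltr01 divr_gt0.
move=> h; rewrite lt_min => /andP[h1 hC].
rewrite gD (addrC x) addrK -mulmxBr.
apply: le_trans (nrmM _ _) _; rewrite mulrC ler_wpM2r //.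
have [||_] := DC (h + x, x) (x, x).
- split; rewrite /nball /=; last by lra.
  by have := nrmD (S := S) h x; lra.
- by split; rewrite /nball /=; lra.
rewrite /dist2 /= addrK subrr nrm0 addr0 => /le_trans; apply.
by rewrite mulrC -ler_pdivlMr // ltW.
Qed.

End Differentials.

(** * Points at infinity of a cylinder *)

Section LinearInfinity.
Local Open Scope quotient_scope.
Context (R : realType) (K : numFieldType) (abs : K -> R) {S : scalars abs}.
Variables (n k : nat) (M : 'M[K]_(n, k)) (Mi : 'M[K]_(k, n)).
Hypothesis MiM : Mi *m M = 1%:M.

(** Right multiplication by [omit i] inserts a zero coordinate at place i. *)
Definition omit (i : 'I_n.+1) : 'M[K]_(n, n.+1) := row' i 1%:M.

Lemma omitE i l j : omit i l j = (lift i l == j)%:R.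
Proof. by rewrite !mxE. Qed.

Lemma omit_mul i q (A : 'M[K]_(n.+1, q)) : omit i *m A = row' i A.
Proof.
apply/matrixP => l j; rewrite !mxE (bigD1 (lift i l)) //= big1 ?addr0.
  by rewrite omitE eqxx mul1r.
by move=> l' l'l; rewrite omitE eq_sym (negbTE l'l) mul0r.
Qed.

Lemma neq_liftF (i : 'I_n.+1) l : (i == lift i l) = false.
Proof. exact/negbTE/neq_lift. Qed.

Lemma lift_neqF (i : 'I_n.+1) l : (lift i l == i) = false.
Proof. by rewrite eq_sym neq_liftF. Qed.

Lemma chart_vecE i (x : 'rV[K]_n) :
  chart_vec i x = delta_mx 0 i + x *m omit i.
Proof.
apply/rowP => j; rewrite !mxE eqxx /=; case: unliftP => [l ->|->].
  rewrite lift_neqF add0r (bigD1 l) //= big1.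
    by rewrite omitE eqxx mulr1 addr0.
  by move=> l' l'l; rewrite omitE (inj_eq lift_inj) (negbTE l'l) mulr0.
rewrite eqxx big1 ?addr0 // => l _.
by rewrite omitE lift_neqF mulr0.
Qed.

Definition affine_part (w : 'rV[K]_n.+1) : 'rV[K]_n := w *m (omit ord_max)^T.

(** The linear equations, in homogeneous coordinates w, of the points at infinity
    in the directions of the kernel of M. *)
Definition hom_mx : 'M[K]_(n.+1, k + 1) :=
  row_mx ((omit ord_max)^T *m M) (delta_mx ord_max 0).

Lemma hom_mxE w : w *m hom_mx = row_mx (affine_part w *m M) (w 0 ord_max)%:M.
Proof.
rewrite mul_mx_row mulmxA; congr row_mx.
by apply/rowP => j; rewrite (ord1 j) -colE !mxE eqxx mulr1n.
Qed.

Lemma omit_tr : omit ord_max *m (omit ord_max)^T = 1%:M.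
Proof.
apply/matrixP => i j; rewrite mxE (bigD1 (lift ord_max i)) //= big1 ?addr0.
  by rewrite [_^T _ _]mxE !omitE eqxx mul1r (inj_eq lift_inj) mxE eq_sym.
by move=> l li; rewrite omitE eq_sym (negbTE li) mul0r.
Qed.

Lemma affine_part_chart (x : 'rV[K]_n) : affine_part (chart_vec ord_max x) = x.
Proof.
rewrite /affine_part chart_vecE mulmxDl -mulmxA omit_tr mulmx1 -rowE.
rewrite (_ : row _ _ = 0) ?add0r //; apply/rowP => j.
by rewrite !mxE lift_neqF.
Qed.

Lemma last_chart (x : 'rV[K]_n) : chart_vec ord_max x 0 ord_max = 1.
Proof. by rewrite mxE unlift_none. Qed.

Lemma rV_affine_part (w : 'rV[K]_n.+1) :
  w = affine_part w *m omit ord_max + w 0 ord_max *: delta_mx 0 ord_max.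
Proof.
apply/rowP => j; rewrite [RHS]mxE [X in _ = _ + X]mxE [X in _ = _ + _ * X]mxE eqxx /=.
case: (unliftP ord_max j) => [l ->|->].
  rewrite lift_neqF mulr0 addr0 mxE (bigD1 l) //= big1.
    rewrite omitE eqxx mulr1 addr0 mxE (bigD1 (lift ord_max l)) //= big1.
      by rewrite mxE omitE eqxx mulr1 addr0.
    by move=> j' j'l; rewrite mxE omitE eq_sym (negbTE j'l) mulr0.
  by move=> l' l'l; rewrite omitE (inj_eq lift_inj) (negbTE l'l) mulr0.
rewrite eqxx mulr1 mxE big1 ?add0r // => l _.
by rewrite omitE lift_neqF mulr0.
Qed.

Lemma hom_mx_left_inverse : exists V, V *m hom_mx = 1%:M.
Proof.
exists (col_mx (Mi *m omit ord_max) (delta_mx 0 ord_max)).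
rewrite mul_col_mx !mul_mx_row -mulmxA (mulmxA (omit _)) omit_tr mul1mx MiM.
rewrite -mulmxA -colE mulmxA -rowE.
have -> : col ord_max (omit ord_max) = 0.
  by apply/colP => l; rewrite !mxE lift_neqF.
have -> : row ord_max (omit ord_max)^T = 0.
  by apply/rowP => l; rewrite !mxE lift_neqF.
rewrite mulmx0 mul0mx mul_delta_mx.
have -> : delta_mx 0 0 = 1%:M :> 'M[K]_1.
  by apply/matrixP => i j; rewrite !ord1 !mxE.
by rewrite [RHS]scalar_mx_block.
Qed.

(** A solution x in chart i expresses row i of the system through the other rows,
    so removing this row does not lower the rank. *)
Lemma rank_row'_hom i (x : 'rV[K]_n) :
  chart_vec i x *m hom_mx = 0 -> (k < n)%N /\ \rank (kermx (row' i hom_mx)) = (n - k.+1)%N.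
Proof.
rewrite chart_vecE mulmxDl -rowE -mulmxA => xW.
have EW := omit_mul i hom_mx.
have [V VW] := hom_mx_left_inverse.
pose Z : 'M[K]_(n.+1, n) := \matrix_j (if unlift i j is Some l then delta_mx 0 l else - x).
have ZW : Z *m row' i hom_mx = hom_mx.
  apply/row_matrixP => j; rewrite row_mul rowK; case: unliftP => [l ->|->].
    by rewrite -rowE; apply/rowP => q; rewrite !mxE.
  rewrite mulNmx -EW; apply/eqP; rewrite eq_sym -subr_eq0 opprK; exact/eqP.
have rk : \rank (row' i hom_mx) = k.+1.
  apply/eqP; rewrite -[k.+1]addn1 -/(row_full _).
  by apply/row_fullP; exists (V *m Z); rewrite -mulmxA ZW.
by rewrite mxrank_ker rk -{1}rk rank_leq_row.
Qed.

(** In a chart, T satisfies an affine system, so the differential of an immersion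
    into T takes its values in the kernel of the linear part, whose dimension is
    n - (k + 1). *)
Lemma submanifold_le (T : set (projspace K n)) d :
  (forall i x, T (chart i x) -> chart_vec i x *m hom_mx = 0) ->
  contains_submanifold T d -> (d.+1 <= n - k)%N.
Proof.
move=> TW [i [U [phi [oU [u0 U0] phiU TU]]]].
have hW u : U u -> chart_vec i (phi u) *m hom_mx = 0 by move=> /TU /TW.
have EW := omit_mul i hom_mx.
have [kn rk] := rank_row'_hom (hW _ U0).
have [dphi iphi _] := phiU u0 U0.
set B := row' i hom_mx in rk EW *.
(* The increments of phi are killed by B, and the differential is their limit. *)
have kill v : 'd phi u0 v *m B = 0.
  apply: (nrm_le0 (abs := abs)).
  apply/ler_addgt0Pr => e e0; rewrite add0r.
  have c0 : 0 < nrm abs B * nrm abs v + 1.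
    by rewrite ltr_wpDl // mulr_ge0 // nrm_ge0.
  have [d1 d10 dphiP] := differentiable_nrm dphi (divr_gt0 e0 c0).
  have /nbhs_nrm[d2 d20 dU] : nbhs u0 U by apply: open_nbhs_nbhs.
  pose t := Num.min d1 d2 / (nrm abs v + 1).
  have v1 : 0 < nrm abs v + 1 by rewrite ltr_wpDl // nrm_ge0.
  have t0 : 0 < t by rewrite divr_gt0 // lt_min d10.
  have tv : nrm abs (emb S t *: v) < Num.min d1 d2.
    rewrite nrmZ abs_emb gtr0_norm // /t mulrAC ltr_pdivrMr // ltr_pM2l ?ltrDl //.
    by rewrite lt_min d10.
  move: tv; rewrite lt_min => /andP[/dphiP {}dphiP tv].
  have Ut : U (u0 + emb S t *: v).
    by apply: dU; rewrite (addrC u0) addrK.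
  have phiB : (phi (u0 + emb S t *: v) - phi u0) *m B = 0.
    rewrite -EW mulmxA mulmxBl.
    have := hW _ Ut; have := hW _ U0; rewrite !chart_vecE.
    move=> h0 h1; have : (delta_mx 0 i + phi (u0 + emb S t *: v) *m omit i -
      (delta_mx 0 i + phi u0 *m omit i)) *m hom_mx = 0.
      by rewrite mulmxBl h0 h1 subr0.
    by rewrite opprD addrACA subrr add0r.
  have : nrm abs ((phi (u0 + emb S t *: v) - phi u0 - 'd phi u0 (emb S t *: v)) *m B)
     <= e / (nrm abs B * nrm abs v + 1) * (t * nrm abs v) * nrm abs B.
    apply: le_trans (nrmM _ _) _; apply: ler_wpM2r; first exact: nrm_ge0.
    by apply: le_trans dphiP _; rewrite nrmZ abs_emb gtr0_norm.
  rewrite mulmxBl phiB add0r nrmN linearZ /= -scalemxAl nrmZ abs_emb gtr0_norm //.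
  have -> : e / (nrm abs B * nrm abs v + 1) * (t * nrm abs v) * nrm abs B =
    t * (e * (nrm abs B * nrm abs v) / (nrm abs B * nrm abs v + 1)) by ring.
  rewrite ler_pM2l // => /le_trans; apply.
  by rewrite ler_pdivrMr // ler_pM2l // lerDl.
have Lfree : row_free (lin1_mx ('d phi u0)).
  apply: inj_row_free => v.
  rewrite mul_rV_lin1 => v0; apply: iphi; rewrite v0.
  by rewrite linear0.
have : (lin1_mx ('d phi u0) <= kermx B)%MS.
  by apply/sub_kermxP/row_matrixP => j; rewrite row_mul !rowE mul_rV_lin1 kill mulmx0.
by move=> /mxrankS; rewrite rk (eqP Lfree) -ltnS -subSn // subSS.
Qed.

(** In a chart that it meets, the solution set is an affine space: parametrise it
    by a basis of the kernel. *)
Lemma contains_kernel (T : set (projspace K n)) :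
  (k < n)%N ->
  (forall i x, chart_vec i x *m hom_mx = 0 -> T (chart i x)) ->
  contains_submanifold T (n - k.+1).
Proof.
move=> kn TW.
(* a nonzero vector of the kernel, scaled to meet one of the charts *)
have [v vM v0] : exists2 v : 'rV[K]_n, v *m M = 0 & v != 0.
  have : kermx M != 0.
    rewrite -mxrank_eq0 mxrank_ker -lt0n subn_gt0.
    exact: leq_ltn_trans (rank_leq_col M) kn.
  by move=> /rowV0Pn[v /sub_kermxP vM v0]; exists v.
have [l vl] : exists l, v 0 l != 0.
  apply/existsP; apply: contraNT v0; rewrite negb_exists => /forallP v0.
  by apply/eqP/rowP => l; rewrite mxE; apply/eqP; rewrite -[_ == _]negbK.
pose i := lift ord_max l.
pose w := (v 0 l)^-1 *: v *m omit ord_max.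
have wi : w 0 i = 1.
  rewrite /w mxE (bigD1 l) //= big1.
    by rewrite omitE eqxx mulr1 addr0 mxE mulVf.
  by move=> l' l'l; rewrite omitE (inj_eq lift_inj) (negbTE l'l) mulr0.
have wmax : w 0 ord_max = 0.
  by rewrite /w mxE big1 // => l' _; rewrite omitE lift_neqF mulr0.
pose x : 'rV[K]_n := w *m (omit i)^T.
have xw : chart_vec i x = w.
  apply/rowP => j; rewrite mxE; case: unliftP => [l' ->|->]; last by rewrite wi.
  rewrite /x mxE (bigD1 (lift i l')) //= big1.
    by rewrite [_^T _ _]mxE omitE eqxx mulr1 addr0.
  by move=> j' j'l; rewrite [_^T _ _]mxE omitE eq_sym (negbTE j'l) mulr0.
have xW : chart_vec i x *m hom_mx = 0.
  rewrite xw hom_mxE /w /affine_part -!scalemxAl -(mulmxA v) omit_tr mulmx1 vM.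
  by rewrite scaler0 scalemxAl wmax raddf0 row_mx0.
have [_ rk] := rank_row'_hom xW.
have [Q [Qfree QW]] : exists Q : 'M[K]_(n - k.+1, n),
    row_free Q /\ Q *m row' i hom_mx = 0.
  rewrite -rk; exists (row_base (kermx (row' i hom_mx))).
  split; first exact: row_base_free.
  by apply/sub_kermxP; rewrite eq_row_base.
pose phi (u : 'rV[K]_(n - k.+1)) := x + u *m Q.
have dphi u v' : 'd phi u v' = v' *m Q.
  apply: diff_nrm => e e0; exists 1 => // h _.
  have -> : phi (u + h) - phi u - h *m Q = 0.
    by rewrite /phi mulmxDl [x + (_ + _)]addrA [x + _ + _]addrC addrK subrr.
  by rewrite nrm0 mulr_ge0 ?nrm_ge0 // ltW.
exists i, setT, phi; split.
- exact: openT.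
- by exists 0.
- move=> u _; split.
  + apply: (@differentiableD _ _ _ (cst x) (mulmxr Q)); first exact: differentiable_cst.
    by apply: linear_differentiable; apply: mulmxr_continuous.
  + move=> a b; rewrite !dphi => /eqP; rewrite -subr_eq0 -mulmxBl => /eqP ab.
    apply/eqP; rewrite -subr_eq0; apply/eqP.
    by apply: (row_free_inj Qfree); rewrite mul0mx.
  + move=> v'; rewrite /prop_for (_ : (fun u' => 'd phi u' v') = cst (v' *m Q)).
      exact: cst_continuous.
    by apply/funext => u'; rewrite dphi.
- move=> u _; apply: TW; rewrite chart_vecE mulmxDl -(mulmxA (phi u)) omit_mul /phi.
  rewrite mulmxDl -(mulmxA u) QW mulmx0 addr0.
  by move: xW; rewrite chart_vecE mulmxDl -mulmxA omit_mul.
Qed.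


Notation pi_ := (\pi_{eq_quot (@proportional_equiv K n)}).

Lemma nonzero_vecP (v : nonzero_vec K n) : set_val v != 0.
Proof. exact: (set_valP v). Qed.

Lemma proportional_pi (u v : nonzero_vec K n) a :
  set_val v = a *: set_val u -> pi_ u = pi_ v.
Proof.
move=> va; have a0 : a != 0.
  by apply/eqP => a0; move: (nonzero_vecP v); rewrite va a0 scale0r eqxx.
apply/eqmodP; rewrite /= /proportional; apply/andP; split; apply/sub_rVP.
  by exists a^-1; rewrite va scalerA mulVf // scale1r.
by exists a.
Qed.

Lemma pi_proportional (u v : nonzero_vec K n) :
  pi_ u = pi_ v -> exists2 a, a != 0 & set_val v = a *: set_val u.
Proof.
move=> /eqmodP /= /andP[_ /sub_rVP[a va]]; exists a => //.
by apply/eqP => a0; move: (nonzero_vecP v); rewrite va a0 scale0r eqxx.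
Qed.

Lemma affine_partZ a w : affine_part (a *: w) = a *: affine_part w.
Proof. by rewrite /affine_part scalemxAl. Qed.

Lemma pi_embed (u : nonzero_vec K n) :
  set_val u 0 ord_max != 0 ->
  pi_ u = embed ((set_val u 0 ord_max)^-1 *: affine_part (set_val u)).
Proof.
move=> t0; apply/esym; apply: (@proportional_pi _ _ (set_val u 0 ord_max)).
rewrite set_valE /= chart_vecE scalerDr -scalemxAl scalerA divff // scale1r addrC.
exact: rV_affine_part.
Qed.

Variables (X : set 'rV[K]_n) (C : R).
Hypothesis X_bounded : forall x, X x -> nrm abs (x *m M) <= C.

(** The directions that leave the cylinder |x M| <= C.  This cone is open and
    invariant under scaling, so it is a neighbourhood in projective space of each
    of its points; it contains no point of X. *)
Let steep := [set w : 'rV[K]_n.+1 |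
  C * abs (w 0 ord_max) < nrm abs (affine_part w *m M)].

Lemma steep_open : open steep.
Proof.
rewrite -(setCK steep); apply: closed_openC; apply: (closed_nrm (S := S)) => w wcl /=.
apply/negP; rewrite -leNgt; apply/ler_addgt0Pr => e e0.
pose L := nrm abs (omit ord_max)^T * nrm abs M + `|C|.
have L0 : 0 <= L by rewrite addr_ge0 // mulr_ge0 // nrm_ge0.
have [|w' /negP + w'w] := wcl (e / (L + 1)).
  by rewrite divr_gt0 // ltr_wpDl.
rewrite /steep /= -leNgt => w'C.
have t : `|C * abs (w' 0 ord_max) - C * abs (w 0 ord_max)| <= `|C| * nrm abs (w' - w).
  rewrite -mulrBr normrM ler_wpM2l // ler_norml.
  have := absD (S := S) (w' 0 ord_max - w 0 ord_max) (w 0 ord_max).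
  have := absD (S := S) (w 0 ord_max - w' 0 ord_max) (w' 0 ord_max).
  have := abs_le_nrm (S := S) (w' - w) 0 ord_max; rewrite !mxE !subrK (absBC (w 0 ord_max)).
  by move=> *; apply/andP; split; lra.
have a : nrm abs (affine_part w *m M) <= nrm abs (affine_part w' *m M) +
    nrm abs (w' - w) * (nrm abs (omit ord_max)^T * nrm abs M).
  rewrite -lerBlDl.
  apply: le_trans (_ : nrm abs (affine_part w *m M - affine_part w' *m M) <= _).
    by rewrite lerBlDr; apply: le_trans (nrmD _ _); rewrite subrK.
  rewrite /affine_part -!mulmxA -mulmxBl; apply: le_trans (nrmM _ _) _.
  by rewrite (nrmBC w') ler_wpM2l ?nrmM // nrm_ge0.
have : nrm abs (w' - w) * L <= e.
  apply: ltW; apply: le_lt_trans (_ : nrm abs (w' - w) * (L + 1) < _).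
    by rewrite ler_wpM2l ?lerDl // nrm_ge0.
  by rewrite -ltr_pdivlMr // ltr_wpDl.
move: t; rewrite ler_norml /L => /andP[]; nra.
Qed.

(** A point at infinity outside the kernel of M is steep. *)
Lemma accum_infty_hom u : accum_infty X (pi_ u) -> set_val u *m hom_mx = 0.
Proof.
move=> [ucl uH].
have t0 : set_val u 0 ord_max = 0.
  apply: contra_notP uH => /eqP t0; rewrite (pi_embed t0).
  by eexists.
rewrite hom_mxE t0 raddf0.
suff -> : affine_part (set_val u) *m M = 0 by rewrite row_mx0.
apply: (nrm_le0 (abs := abs)); rewrite leNgt; apply/negP => T0.
have [|p [[x Xx <-] [u' /= u'S]]] := ucl (pi_ @` (set_val @^-1` steep)).
  apply: open_nbhs_nbhs; split; last first.
    by exists u => //; rewrite /steep /= t0 (abs0 (abs := abs)) mulr0.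
  exists steep; first exact: steep_open.
  apply/seteqP; split => [v vS|v]; first by exists v.
  move=> [v' v'S /pi_proportional[a a0 va]]; move: v'S.
  rewrite /preimage /steep /mkset va affine_partZ -scalemxAl nrmZ mxE absM mulrCA.
  by rewrite ltr_pM2l // lt_def abs_eq0 a0 abs_ge0.
move=> /pi_proportional[a a0]; rewrite set_valE /= => xu'.
have u'E : set_val u' = a^-1 *: chart_vec ord_max x.
  by rewrite xu' scalerA mulVf // scale1r.
move: u'S; rewrite /steep /= u'E affine_partZ affine_part_chart -scalemxAl nrmZ.
rewrite mxE last_chart mulr1 mulrC ltr_pM2l; first by rewrite ltNge X_bounded.
by rewrite lt_def abs_eq0 invr_eq0 a0 abs_ge0.
Qed.

Hypothesis X_invariant : forall x w, X x -> w *m M = 0 -> X (x + w).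

(** The points x0 + v / t of X have homogeneous coordinates (v, 0) + t (x0, 1),
    which tend to (v, 0) with t. *)
Lemma hom_accum_infty u : X !=set0 -> set_val u *m hom_mx = 0 -> accum_infty X (pi_ u).
Proof.
move=> [x0 Xx0]; rewrite hom_mxE => /eqP.
rewrite row_mx_eq0 => /andP[/eqP uM /eqP ut].
have t0 : set_val u 0 ord_max = 0.
  by move/matrixP/(_ 0 0): ut; rewrite !mxE eqxx mulr1n.
split; last first.
  move=> [x _ /pi_proportional[a a0 ua]].
  move: t0; rewrite ua mxE set_valE /= last_chart mulr1 => a00.
  by rewrite a00 eqxx in a0.
move=> B uB.
have : nbhs u (pi_ @^-1` B) 
  by have := @pi_continuous (nonzero_vec K n) {eq_quot (@proportional_equiv K n)} u; apply.
rewrite nbhsE => -[_ [[V oV <-] uV] VB].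
have /nbhs_nrm[d d0 dV] : nbhs (set_val u) V by apply: open_nbhs_nbhs.
pose y : 'rV[K]_n.+1 := chart_vec ord_max x0.
pose t := d / (2 * (nrm abs y + 1)).
have y1 : 0 < nrm abs y + 1 by rewrite ltr_wpDl // nrm_ge0.
have t_gt0 : 0 < t by rewrite divr_gt0 // mulr_gt0.
pose w := set_val u + emb S t *: y.
have wt : w 0 ord_max = emb S t by rewrite mxE t0 add0r mxE last_chart mulr1.
have et0 : emb S t != 0 by rewrite -(abs_eq0 (abs := abs)) abs_emb normr_eq0 gt_eqF.
have w0 : w != 0.
  by apply: contra_neq et0 => w0; rewrite -wt w0 mxE.
pose u' : nonzero_vec K n := exist _ w (mem_set w0).
have u'w : set_val u' = w by rewrite set_valE.
exists (pi_ u'); split; last first.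
  apply: VB => /=; rewrite u'w; apply: dV.
  rewrite /w addrC addKr nrmZ abs_emb gtr0_norm //.
  rewrite /t -mulrA -ltr_pdivlMl // mulVf ?gt_eqF // ltr_pdivrMl ?mulr_gt0 //.
  by rewrite mulr1; have := nrm_ge0 (S := S) y; lra.
rewrite pi_embed u'w wt //.
exists ((emb S t)^-1 *: affine_part w) => //.
have -> : (emb S t)^-1 *: affine_part w = x0 + (emb S t)^-1 *: affine_part (set_val u).
  rewrite /w {1}/affine_part mulmxDl -scalemxAl -!/(affine_part _) affine_part_chart.
  by rewrite scalerDr scalerA mulVf // scale1r addrC.
by apply: X_invariant => //; rewrite -scalemxAl uM scaler0.
Qed.

(** X is invariant under the kernel of M and bounded modulo it, so its points at
    infinity form the projective space of this kernel. *)
Lemma proj_dim_accum_infty : ((k < n)%N -> X !=set0) ->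
  proj_dim (accum_infty X) = n%:Z - 1 - k%:Z.
Proof.
move=> X0.
have kn : (k <= n)%N.
  have := rank_leq_col Mi; suff -> : \rank Mi = k by [].
  by apply/eqP; rewrite -/(row_free _); apply/row_freeP; exists M.
rewrite /proj_dim (_ : (\max_(d < _ | _) _)%N = n - k)%N; first lia.
apply/eqP; rewrite eqn_leq; apply/andP; split.
  apply/bigmax_leqP => d /asboolP; apply: submanifold_le => i x.
  by move=> /accum_infty_hom; rewrite set_valE.
case: (ltnP k n) => [ltkn|nk]; last by move: nk; rewrite -subn_eq0 => /eqP ->.
have dn : (n - k.+1 < n.+1)%N by rewrite ltnS leq_subr.
apply: leq_trans (leq_bigmax_cond (Ordinal dn) _); first by rewrite /= subnSK.
apply/asboolP => /=; apply: contains_kernel => // i x ix.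
by apply: hom_accum_infty; [exact: X0|rewrite set_valE].
Qed.

End LinearInfinity.

(** * Polynomials bounded near a set *)

Section FiniteDifferences.
Context (K : numFieldType) (n : nat).
Implicit Types (q f g : 'rV[K]_n -> K).

Definition fdiff v q : 'rV[K]_n -> K := fun x => q (x + v) - q x.

(** Degree in the sense of Frechet: d + 1 successive differences vanish.  It needs
    no coefficients, and a difference along a short vector only involves the
    values on a slightly larger set. *)
Fixpoint fdegree_le d q : Prop :=
  if d is d'.+1 then forall v, fdegree_le d' (fdiff v q)
  else forall x y, q x = q y.

Lemma fdegree_leS d q : fdegree_le d q -> fdegree_le d.+1 q.
Proof.
elim: d q => [|d IH] q /= qd v; last by apply: IH.
by move=> x y; rewrite /fdiff (qd (x + v) x) (qd (y + v) y) !subrr.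
Qed.

Lemma fdegree_le_trans d e q : (d <= e)%N -> fdegree_le d q -> fdegree_le e q.
Proof.
move=> /subnKC <-; elim: (e - d)%N => [|i IH]; first by rewrite addn0.
by move=> /IH /fdegree_leS; rewrite addnS.
Qed.

Lemma fdegree_leD d f g :
  fdegree_le d f -> fdegree_le d g -> fdegree_le d (fun x => f x + g x).
Proof.
elim: d f g => [|d IH] f g /= fd gd => [x y|v]; first by rewrite (fd x y) (gd x y).
rewrite (_ : fdiff _ _ = fun x => fdiff v f x + fdiff v g x); first exact: IH.
by apply/funext => x; rewrite /fdiff opprD addrACA.
Qed.

Lemma fdegree_le_shift d f w : fdegree_le d f -> fdegree_le d (fun x => f (x + w)).
Proof.
elim: d f => [|d IH] f /= fd => [x y|v]; first exact: fd.
rewrite (_ : fdiff _ _ = fun x => fdiff v f (x + w)); first exact: IH.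
by apply/funext => x; rewrite /fdiff addrAC.
Qed.

(** Leibniz rule for differences, and induction on a + b. *)
Lemma fdegree_leM a b f g : fdegree_le a f -> fdegree_le b g ->
  fdegree_le (a + b) (fun x => f x * g x).
Proof.
have [N] := ubnP (a + b).
elim: N a b f g => // N IH a b f g; rewrite ltnS => abN fa gb.
have cstl c e h : fdegree_le e h -> fdegree_le e (fun x => c * h x).
  elim: e h => [|e IHe] h /= hd => [x y|v]; first by rewrite (hd x y).
  rewrite (_ : fdiff _ _ = fun x => c * fdiff v h x); first exact: IHe.
  by apply/funext => x; rewrite /fdiff mulrBr.
case: a fa abN => [|a] fa abN.
  rewrite (_ : (fun x => _) = fun x => f 0 * g x); first exact: cstl.
  by apply/funext => x; rewrite (fa x 0).
case: b gb abN => [|b] gb abN.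
  rewrite addn0 (_ : (fun x => _) = fun x => g 0 * f x); first exact: cstl.
  by apply/funext => x; rewrite (gb x 0) mulrC.
rewrite addSn /= => v.
rewrite (_ : fdiff _ _ = fun x => fdiff v f x * g (x + v) + f x * fdiff v g x).
  apply: fdegree_leD.
    by apply: (IH a b.+1); [lia|exact: fa|apply: (@fdegree_le_shift b.+1)].
  by rewrite -addSnnS; apply: (IH a.+1 b); [lia|exact: fa|exact: gb].
by apply/funext => x; rewrite /fdiff; ring.
Qed.

Lemma polyfun_fdegree q : polyfun q -> exists d, fdegree_le d q.
Proof.
elim=> [c|i|f g _ [a fa] _ [b gb]|f g _ [a fa] _ [b gb]].
- by exists 0%N.
- by exists 1%N => v x y; rewrite /fdiff !mxE addrAC subrr add0r addrAC subrr add0r.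
- exists (maxn a b); apply: fdegree_leD.
    by apply: fdegree_le_trans fa; rewrite leq_maxl.
  by apply: fdegree_le_trans gb; rewrite leq_maxr.
- by exists (a + b)%N; apply: fdegree_leM.
Qed.

Lemma polyfun_shift q v : polyfun q -> polyfun (fun x => q (x + v)).
Proof.
move=> qp; have := polyfun_affine 1%:M v qp.
by under [fun x => _]eq_fun do rewrite mulmx1.
Qed.

Lemma polyfun_fdiff v q : polyfun q -> polyfun (fdiff v q).
Proof.
move=> qp; rewrite (_ : fdiff v q = fun x => q (x + v) + (-1) * q x).
  by apply: polyfunD; [exact: polyfun_shift|apply: polyfunM => //; exact: polyfun_cst].
by apply/funext => x; rewrite /fdiff mulN1r.
Qed.

Lemma polyfun_line q x w : polyfun q ->
  exists P : {poly K}, forall u, q (x + u *: w) = P.[u].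
Proof.
elim=> [c|i|f g _ [P PE] _ [Q QE]|f g _ [P PE] _ [Q QE]].
- by exists c%:P => u; rewrite hornerC.
- by exists ((x 0 i)%:P + w 0 i *: 'X) => u; rewrite !hornerE !mxE mulrC.
- by exists (P + Q) => u; rewrite hornerD PE QE.
- by exists (P * Q) => u; rewrite hornerM PE QE.
Qed.

Lemma poly_nat_roots (P : {poly K}) : (forall k : nat, P.[k%:R] = 0) -> P = 0.
Proof.
move=> P0; apply/eqP; apply: contraT => Pn0.
have := max_poly_roots (rs := [seq i%:R | i <- iota 0 (size P)]) Pn0.
rewrite size_map size_iota ltnn => -> //.
  by apply/allP => _ /mapP[i _ ->]; rewrite /root P0.
rewrite map_inj_uniq ?iota_uniq // => i j ij.
by apply/eqP; rewrite -(eqr_nat K) ij.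
Qed.

End FiniteDifferences.

Section BoundedForms.
Context (R : realType) (K : numFieldType) (abs : K -> R) {S : scalars abs}.
Variables (n : nat) (X : set 'rV[K]_n).

Definition bounded_form k (A : 'M[K]_(n, k)) :=
  exists C, forall x, X x -> nrm abs (x *m A) <= C.

(** A family of independent forms bounded on X, of maximal size: a bounded form l
    with w l <> 0 for some w in the kernel could be added to it. *)
Lemma max_bounded_form : exists k (A : 'M[K]_(n, k)) (Ai : 'M[K]_(k, n)),
  [/\ Ai *m A = 1%:M, bounded_form A,
      forall l : 'cV[K]_n, bounded_form l ->
        forall w : 'rV[K]_n, w *m A = 0 -> w *m l = 0
    & (k < n)%N -> X !=set0].
Proof.
pose P k := `[< exists (A : 'M[K]_(n, k)) (Ai : 'M[K]_(k, n)),
  Ai *m A = 1%:M /\ bounded_form A >].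
have P0 : exists k, P k.
  exists 0%N; apply/asboolP; exists 0, 0; split.
    by apply/matrixP => -[].
  by exists 0 => x _; rewrite mulmx0 nrm0.
have Pn k : P k -> (k <= n)%N.
  move=> /asboolP[A [Ai [AiA _]]].
  have := rank_leq_col Ai; suff -> : \rank Ai = k by [].
  by apply/eqP; rewrite -/(row_free _); apply/row_freeP; exists A.
case: (ex_maxnP P0 Pn) => k /asboolP[A [Ai [AiA Abd]]] kmax.
exists k, A, Ai; split=> //.
  move=> l [C lC] w wA; apply/eqP; apply: contraT => wl0.
  pose b := (w *m l) 0 0.
  have b0 : b != 0.
    by apply: contraNneq wl0 => b0; apply/eqP/matrixP => i j; rewrite !ord1 [RHS]mxE.
  pose w' := b^-1 *: w.
  have w'A : w' *m A = 0 by rewrite -scalemxAl wA scaler0.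
  have w'l : w' *m l = 1%:M.
    by apply/matrixP => i j; rewrite !ord1 -scalemxAl mxE -/b mulVf // mxE.
  suff /kmax : P (k + 1)%N by rewrite addn1 ltnn.
  apply/asboolP; exists (row_mx A l), (col_mx (Ai - Ai *m l *m w') w'); split.
    rewrite mul_col_mx !mul_mx_row !mulmxBl -!mulmxA w'A w'l AiA !mulmx0 mulmx1.
    by rewrite subr0 subrr [RHS]scalar_mx_block.
  case: Abd => D AD; exists (D + C) => x Xx.
  by rewrite mul_mx_row nrm_row_mx lerD // ?AD ?lC.
move=> kn; apply: contrapT => X0.
suff /kmax : P n by rewrite leqNgt kn.
apply/asboolP; exists 1%:M, 1%:M; split; first by rewrite mulmx1.
by exists 0 => x Xx; case: X0; exists x.
Qed.

Variables (k : nat) (A : 'M[K]_(n, k)) (Ai : 'M[K]_(k, n)).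
Hypothesis AiA : Ai *m A = 1%:M.
Hypothesis A_bounded : bounded_form A.
Hypothesis A_max : forall l : 'cV[K]_n, bounded_form l ->
  forall w : 'rV[K]_n, w *m A = 0 -> w *m l = 0.

(** Any vector is a multiple of a short one. *)
Lemma small_periods (h : 'rV[K]_n -> K) e : 0 < e ->
  (forall x v, nrm abs v < e -> h (x + v) = h x) -> forall x, h x = h 0.
Proof.
move=> e0 hv x.
pose N := (Num.truncn (nrm abs x / e)).+1.
have N0 : (0 : R) < N%:R by rewrite ltr0Sn.
have NK : (N%:R : K) != 0 by rewrite pnatr_eq0.
have hN i : h (i%:R *: (N%:R^-1 *: x)) = h 0.
  elim: i => [|i <-]; first by rewrite scale0r.
  rewrite -[i.+1%:R]natr1 scalerDl scale1r; apply: hv.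
  rewrite nrmZ absV -(rmorph_nat (emb S)) abs_emb gtr0_norm //.
  by rewrite ltr_pdivrMl // -ltr_pdivrMr // truncnS_gt.
by rewrite -(hN N) scalerA divff // scale1r.
Qed.

(** If the finite differences of q are invariant under the kernel of A, then
    translation by w in this kernel changes q by a linear form in w; boundedness
    of q makes that form bounded on X, so it vanishes on the kernel. *)
Lemma tube_bounded_invariant d q e C : fdegree_le d q -> polyfun q -> 0 < e ->
  (forall x z, X x -> nrm abs z < e -> abs (q (x + z)) <= C) ->
  forall x w, w *m A = 0 -> q (x + w) = q x.
Proof.
elim: d q e C => [|d IH] q e C qd qp e0 qC x w wA; first exact: qd.
have e2 : 0 < e / 2 by lra.
have inv v : nrm abs v < e / 2 -> forall x w, w *m A = 0 ->
    fdiff v q (x + w) = fdiff v q x.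
  move=> ve; apply: (IH _ (e / 2) (C + C)) => //; first exact: polyfun_fdiff.
  move=> y z Xy ze; rewrite /fdiff; apply: le_trans (absD _ _) _; rewrite absN.
  apply: lerD; last by apply: qC => //; lra.
  rewrite -addrA; apply: qC => //; apply: le_lt_trans (nrmD _ _) _; lra.
pose la w := q w - q 0.
have laE y v : v *m A = 0 -> q (y + v) = q y + la v.
  move=> vA; have := @small_periods (fun y => q (y + v) - q y) (e / 2) e2.
  move=> /(_ _ y) h; rewrite /la; have /h : forall y z, nrm abs z < e / 2 ->
      q (y + z + v) - q (y + z) = q (y + v) - q y.
    move=> y' z ze; have := inv z ze y' v vA; rewrite /fdiff (addrAC y' v).
    by move=> /(canRL (subrK _)) ->; ring.
  by rewrite /= add0r => <-; ring.
have laD u v : u *m A = 0 -> v *m A = 0 -> la (u + v) = la u + la v.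
  by move=> uA vA; rewrite {1}/la laE // addrAC.
have la0 : la 0 = 0 by rewrite /la subrr.
have laMn v i : v *m A = 0 -> la (i%:R *: v) = i%:R * la v.
  move=> vA; elim: i => [|i IHi]; first by rewrite scale0r mul0r.
  rewrite -[i.+1%:R]natr1 scalerDl scale1r laD ?IHi ?mulrDl ?mul1r //.
  by rewrite -scalemxAl vA scaler0.
have laZ v u : v *m A = 0 -> la (u *: v) = u * la v.
  move=> vA.
  (* Along the line of v, q - q(0) and u |-> u la(v) agree at all natural numbers. *)
  have [P PE] := polyfun_line 0 v qp.
  have : P - (q 0)%:P - la v *: 'X = 0.
    apply: poly_nat_roots => i; rewrite !hornerE -PE add0r.
    by rewrite -/(la _) laMn // mulrC subrr.
  move=> /(congr1 (fun Q => Q.[u])); rewrite !hornerE -PE add0r -/(la _).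
  by move=> /subr0_eq ->; rewrite mulrC.
(* rho projects onto the kernel of A, along the image of Ai. *)
pose rho := 1%:M - A *m Ai.
have rhoA : rho *m A = 0 by rewrite mulmxBl mul1mx -mulmxA AiA mulmx1 subrr.
pose l : 'cV[K]_n := \col_j la (row j rho).
have lE y : (y *m l) 0 0 = la (y *m rho).
  rewrite [y *m rho]mulmx_sum_row mxE.
  have : (forall j, row j rho *m A = 0) by move=> j; rewrite -row_mul rhoA row0.
  move=> rjA.
  suff [-> _] : la (\sum_j y 0 j *: row j rho) = \sum_j y 0 j * la (row j rho) /\
    (\sum_j y 0 j *: row j rho) *m A = 0 by apply: eq_bigr => j _; rewrite mxE.
  elim/big_rec2: _ => [|j s v _ [vs vA]]; first by rewrite mul0mx.
  have jA : y 0 j *: row j rho *m A = 0 by rewrite -scalemxAl rjA scaler0.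
  by rewrite laD // vs laZ // mulmxDl jA vA addr0.
(* y = y A Ai + y rho, so l is q minus its values at the bounded points y A Ai. *)
have lbd : bounded_form l.
  have [D AD] := A_bounded.
  have r0 : 0 < `|D| * nrm abs Ai + 1.
    by rewrite ltr_wpDl // mulr_ge0 // nrm_ge0.
  have [E E0 qE] := polyfun_blip (S := S) r0 qp.
  exists (C + E) => y Xy.
  have -> : nrm abs (y *m l) = abs (q y - q (y *m A *m Ai)).
    rewrite nrm_row big_ord1 lE; congr abs.
    have yE : y *m A *m Ai + y *m rho = y.
      by rewrite mulmxBr mulmx1 mulmxA addrC subrK.
    have := laE (y *m A *m Ai) (y *m rho); rewrite yE -mulmxA rhoA mulmx0.
    by move=> /(_ erefl) ->; ring.
  apply: le_trans (absD _ _) _; rewrite absN lerD //.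
    by rewrite -[y]addr0; apply: qC => //; rewrite nrm0.
  have [||-> //] := qE (y *m A *m Ai) (y *m A *m Ai).
  - rewrite /nball /=; apply: le_trans (nrmM _ _) _; rewrite ler_wpDr //.
    rewrite ler_wpM2r ?nrm_ge0 //; apply: le_trans (AD y Xy) (ler_norm _).
  - rewrite /nball /=; apply: le_trans (nrmM _ _) _; rewrite ler_wpDr //.
    rewrite ler_wpM2r ?nrm_ge0 //; apply: le_trans (AD y Xy) (ler_norm _).
rewrite laE //; have := lE w; rewrite (A_max lbd wA) mxE mulmxBr mulmx1.
by rewrite mulmxA wA mul0mx subr0 => <-; rewrite addr0.
Qed.

End BoundedForms.

(** * Lipschitz trivial values factor through a projection *)

Section Comparison.
Context (R : realType) (K : numFieldType) (abs : K -> R) {S : scalars abs}.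
Let nrm_pos m n (A : 'M[K]_(m, n)) : 0 <= nrm abs A.
Proof. exact: nrm_ge0. Qed.
Let abs_pos (x : K) : 0 <= abs x.
Proof. exact: abs_ge0. Qed.
Hint Resolve nrm_pos abs_pos : core.

Lemma eucl_dist_ge0 n (x y : 'rV[K]_n) : 0 <= eucl_dist abs x y.
Proof. exact: sqrtr_ge0. Qed.
Hint Resolve eucl_dist_ge0 : core.

Lemma eucl_le_nrm n (x y : 'rV[K]_n) : eucl_dist abs x y <= nrm abs (x - y).
Proof.
rewrite /eucl_dist -[leRHS]ger0_norm // -sqrtr_sqr ler_wsqrtr //.
rewrite [in leRHS]nrm_row expr2 mulr_suml; apply: ler_sum => i _.
rewrite expr2 !mxE ler_wpM2l // -[leRHS]nrm_row.
by have := abs_le_nrm (S := S) (x - y) 0 i; rewrite !mxE.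
Qed.

Lemma nrm_le_eucl n (x y : 'rV[K]_n) :
  nrm abs (x - y) <= n%:R * eucl_dist abs x y.
Proof.
rewrite nrm_row mulr_natl -[X in _ *+ X]card_ord -sumr_const.
apply: ler_sum => i _; rewrite !mxE -[leLHS]ger0_norm // -sqrtr_sqr.
rewrite ler_wsqrtr // (bigD1 i) //= lerDl.
by apply: sumr_ge0 => j _; apply: sqr_ge0.
Qed.

Lemma prod_dist_ge_fst n p (u v : 'rV[K]_n * 'rV[K]_p) :
  eucl_dist abs u.1 v.1 <= prod_dist abs u v.
Proof.
by rewrite -[leLHS]ger0_norm // -sqrtr_sqr ler_wsqrtr // lerDl sqr_ge0.
Qed.

Lemma prod_dist_ge_snd n p (u v : 'rV[K]_n * 'rV[K]_p) :
  eucl_dist abs u.2 v.2 <= prod_dist abs u v.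
Proof.
by rewrite -[leLHS]ger0_norm // -sqrtr_sqr ler_wsqrtr // lerDr sqr_ge0.
Qed.

Lemma prod_dist_le n p (u v : 'rV[K]_n * 'rV[K]_p) :
  prod_dist abs u v <= eucl_dist abs u.1 v.1 + eucl_dist abs u.2 v.2.
Proof.
rewrite -[leRHS]ger0_norm ?addr_ge0 // -sqrtr_sqr ler_wsqrtr //.
by rewrite sqrrD -addrA lerD2l lerDr mulrn_wge0 // mulr_ge0.
Qed.

(** The lower Lipschitz bound for the trivialisation makes f Lipschitz near the
    fibre; the upper bound makes each t |-> H x t a Lipschitz section of f. *)
Lemma trivial_sections n p (f : 'rV[K]_n -> 'rV[K]_p) c :
  lipschitz_trivial_value abs f c ->
  exists (r L : R) (H : 'rV[K]_n -> 'rV[K]_p -> 'rV[K]_n), [/\ 0 < r, 0 < L,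
    forall y y', nrm abs (f y - c) < r -> nrm abs (f y' - c) < r ->
      nrm abs (f y - f y') <= L * nrm abs (y - y'),
    forall x t, f x = c -> nrm abs (t - c) < r -> f (H x t) = t /\
      forall t', nrm abs (t' - c) < r ->
      nrm abs (H x t - H x t') <= L * nrm abs (t - t') &
    forall y, nrm abs (f y - c) < r -> exists2 x, f x = c & H x (f y) = y].
Proof.
move=> [V [/nbhs_nrm[r r0 rV] [H [[Hmem _ Hsurj] [L L0 HL] fH]]]].
exists r, ((p%:R + n%:R + 1) * L), (fun x t => H (x, t)).
have Lpos : 0 < (p%:R + n%:R + 1) * L by rewrite mulr_gt0 // ltr_wpDl // addr_ge0.
have Hs y : nrm abs (f y - c) < r -> exists2 x, f x = c & H (x, f y) = y.
  move=> /rV Vfy; have [|[x t] [/= fx Vt] Hxt] := Hsurj y; first exact: Vfy.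
  by exists x => //; rewrite -Hxt fH.
split=> //.
- move=> y y' yr y'r; have [x fx xy] := Hs y yr; have [x' fx' xy'] := Hs y' y'r.
  have /andP[+ _] := HL (x, f y) (x', f y') (conj fx (rV _ yr)) (conj fx' (rV _ y'r)).
  rewrite xy xy' ler_pdivrMl // => h.
  apply: le_trans (nrm_le_eucl _ _) _.
  apply: le_trans (_ : p%:R * (L * nrm abs (y - y')) <= _).
    rewrite ler_wpM2l // (le_trans (prod_dist_ge_snd (x, f y) (x', f y'))) //.
    by rewrite (le_trans h) // ler_pM2l // eucl_le_nrm.
  by rewrite mulrA ler_wpM2r // ler_pM2r // -addrA lerDl addr_ge0.
- move=> x t fx tr; split; first by apply: fH => //; exact: rV.
  move=> t' t'r.
  have /andP[_ h] := HL (x, t) (x, t') (conj fx (rV _ tr)) (conj fx (rV _ t'r)).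
  apply: le_trans (nrm_le_eucl _ _) _.
  apply: le_trans (_ : n%:R * (L * nrm abs (t - t')) <= _).
    rewrite ler_wpM2l // (le_trans h) // ler_pM2l //.
    apply: le_trans (prod_dist_le _ _) _ => /=.
    rewrite (_ : eucl_dist abs x x = 0) ?add0r ?eucl_le_nrm //.
    apply/eqP; rewrite eq_le eucl_dist_ge0 andbT.
    by apply: le_trans (eucl_le_nrm _ _) _; rewrite subrr nrm0.
  by rewrite mulrA ler_wpM2r // ler_pM2r // (addrC p%:R) -addrA lerDl addr_ge0.
Qed.

Lemma polymap_preimage_closed n p (g : 'rV[K]_n -> 'rV[K]_p) (A : set 'rV[K]_p) :
  polymap g -> closed A -> closed (g @^-1` A).
Proof.
move=> gp clA; apply: closed_nrm => u ucl /=.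
apply: (closedP_nrm (S := S) clA) => e e0.
have r0 : 0 < nrm abs u + 1 by rewrite ltr_wpDl.
have [C C0 gC] := polymap_blip (S := S) r0 gp.
have [|v gv vu] := ucl (Num.min 1 (e / C)); first by rewrite lt_min ltr01 divr_gt0.
move: vu; rewrite lt_min => /andP[v1 vC]; exists (g v) => //.
have [||_] := gC v u; rewrite /nball /=.
- by have := nrmD (S := S) (v - u) u; rewrite subrK; lra.
- by lra.
move=> /le_lt_trans; apply.
by rewrite mulrC -ltr_pdivlMr.
Qed.

End Comparison.

Section TrivialImpliesFactorisation.
Context (R : realType) (K : numFieldType) (abs : K -> R) {S : scalars abs}.
Let nrm_pos m n (A : 'M[K]_(m, n)) : 0 <= nrm abs A.
Proof. exact: nrm_ge0. Qed.
Let abs_pos (x : K) : 0 <= abs x.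
Proof. exact: abs_ge0. Qed.
Hint Resolve nrm_pos abs_pos : core.

Variables (n p : nat) (f : 'rV[K]_n -> 'rV[K]_p) (c : 'rV[K]_p).
Hypothesis f_poly : polymap f.
Variables (r L : R) (H : 'rV[K]_n -> 'rV[K]_p -> 'rV[K]_n).
Hypothesis r_gt0 : 0 < r.
Hypothesis L_gt0 : 0 < L.
Hypothesis f_lip : forall y y', nrm abs (f y - c) < r -> nrm abs (f y' - c) < r ->
  nrm abs (f y - f y') <= L * nrm abs (y - y').
Hypothesis H_section : forall x t, f x = c -> nrm abs (t - c) < r ->
  f (H x t) = t /\ forall t', nrm abs (t' - c) < r ->
    nrm abs (H x t - H x t') <= L * nrm abs (t - t').
Hypothesis H_onto : forall y, nrm abs (f y - c) < r ->
  exists2 x, f x = c & H x (f y) = y.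

(** A point of the tube where f left the ball of radius r would, by the
    intermediate value theorem, be preceded by one at distance r / 2 from c,
    which is too far for the Lipschitz bound. *)
Lemma tube_bounded x z : f x = c -> nrm abs z < r / (2 * L) ->
  nrm abs (f (x + z) - c) < r.
Proof.
move=> fx zr; rewrite ltNge; apply/negP => fr.
have r0 : 0 < r by exact: r_gt0.
have L0 : 0 < L by exact: L_gt0.
pose psi (u : R) := nrm abs (f (x + emb S u *: z) - c).
have psi0 : psi 0 = 0 by rewrite /psi rmorph0 scale0r addr0 fx subrr nrm0.
have psi1 : psi 1 = nrm abs (f (x + z) - c) by rewrite /psi rmorph1 scale1r.
have s0 : 0 < nrm abs x + nrm abs z + 1 by rewrite ltr_wpDl // addr_ge0.
have [C C0 fC] := polymap_blip (S := S) s0 f_poly.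
have inb u : 0 <= u <= 1 -> nball abs (n := n) (nrm abs x + nrm abs z + 1) (x + emb S u *: z).
  move=> /andP[u0 u1]; rewrite /nball /=; apply: le_trans (nrmD _ _) _.
  rewrite nrmZ abs_emb ger0_norm // -addrA lerD2l.
  by apply: (@le_trans _ _ (nrm abs z)); [rewrite ler_piMl|rewrite lerDl].
have psi_cont : {within `[0, 1], continuous psi}.
  apply/subspace_continuousP => u /=; rewrite in_itv /= => u01.
  apply/cvgrPdist_lt => e e0.
  have c0 : 0 < C * nrm abs z + 1 by rewrite ltr_wpDl // mulr_ge0 // ltW.
  rewrite near_withinE; apply/nbhs_ballP; exists (e / (C * nrm abs z + 1)).
    by rewrite /= divr_gt0.
  move=> v; rewrite /ball /= in_itv /= => uv v01.
  have [_ fuv] := fC _ _ (inb u u01) (inb v v01).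
  have [_ fvu] := fC _ _ (inb v v01) (inb u u01).
  move: fuv fvu; rewrite /dist1 !opprD !addrA (addrAC x) subrr add0r.
  rewrite (addrAC x) subrr add0r -!scalerBl -!rmorphB !nrmZ !abs_emb (distrC v) => fuv fvu.
  apply: (@le_lt_trans _ _ (C * (`|u - v| * nrm abs z))).
    rewrite /from_subspace ler_norml /psi.
    have := nrm_triangle (S := S) (f (x + emb S u *: z)) (f (x + emb S v *: z)) c.
    have := nrm_triangle (S := S) (f (x + emb S v *: z)) (f (x + emb S u *: z)) c.
    by move=> *; apply/andP; split; lra.
  apply: (@le_lt_trans _ _ (`|u - v| * (C * nrm abs z + 1))).
    by rewrite mulrCA ler_wpM2l // lerDl.
  by rewrite -ltr_pdivlMr.
have [|u] := @IVT _ psi 0 1 (r / 2) ler01 psi_cont.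
  rewrite psi0 psi1 ge_min le_max; apply/andP; split; apply/orP; [left|right].
    by rewrite divr_ge0 // ltW.
  by apply: le_trans fr; rewrite ler_pdivrMr // ler_peMr ?ltW // ltrDl.
rewrite in_itv /= => /andP[u0 u1] psiu.
have := f_lip (y := x + emb S u *: z) (y' := x); rewrite fx subrr nrm0 -/(psi u) psiu.
have -> : nrm abs (x + emb S u *: z - x) = u * nrm abs z.
  by rewrite addrC addKr nrmZ abs_emb ger0_norm.
have : u * nrm abs z <= nrm abs z by rewrite ler_piMl.
move: zr; rewrite ltr_pdivlMr ?mulr_gt0 // => zr uz /(_ _ r_gt0) h.
have : L * (u * nrm abs z) <= L * nrm abs z by rewrite ler_pM2l.
have {}h := h ltac:(lra).

lra.
Qed.

(** f is bounded on a tube around its fibre, so the kernel of the forms that are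
    bounded on the fibre consists of periods of f. *)
Lemma factorisation :
  exists k (A : 'M[K]_(n, k)) (Ai : 'M[K]_(k, n)), [/\ Ai *m A = 1%:M,
    forall x w, w *m A = 0 -> f (x + w) = f x,
    exists C, forall x, f x = c -> nrm abs (x *m A) <= C
    & (k < n)%N -> f @^-1` [set c] !=set0].
Proof.
have [k [A [Ai [AiA Abd Amax Xk]]]] := @max_bounded_form _ _ abs S n (f @^-1` [set c]).
exists k, A, Ai; split=> // x w wA; apply/rowP => i.
have [d fd] := polyfun_fdegree (f_poly i).
apply: (tube_bounded_invariant (S := S) AiA Abd Amax (e := r / (2 * L))
  (C := r + nrm abs c) fd (f_poly i)) => //.
  by rewrite divr_gt0 // mulr_gt0.
move=> y z fy zr; apply: le_trans (abs_le_nrm _ _ _) _.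
have := tube_bounded fy zr; have := nrmD (S := S) (f (y + z) - c) c.
by rewrite subrK; lra.
Qed.

Variables (k : nat) (A : 'M[K]_(n, k)) (Ai : 'M[K]_(k, n)).
Hypothesis AiA : Ai *m A = 1%:M.
Hypothesis f_inv : forall x w, w *m A = 0 -> f (x + w) = f x.
Variable C : R.
Hypothesis X_bounded : forall x, f x = c -> nrm abs (x *m A) <= C.

Let g y := f (y *m Ai).

Lemma f_factor x : f x = g (x *m A).
Proof.
rewrite /g -(f_inv (x *m A *m Ai) (w := x - x *m A *m Ai)).
  by rewrite addrC subrK.
by rewrite mulmxBl -!mulmxA AiA mulmx1 subrr.
Qed.

Lemma g_polymap : polymap g.
Proof.
move=> i; have := polyfun_affine Ai 0 (f_poly i).
by under [fun x => _]eq_fun do rewrite addr0.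
Qed.

(** A point of the preimage of a small ball is joined to the fibre by a section
    of bounded length, and the fibre is bounded modulo the kernel of A. *)
Lemma g_proper : proper_at g c.
Proof.
exists [set t | nrm abs (t - c) < Num.min r 1]; split.
  by apply/nbhs_nrm; exists (Num.min r 1) => //; rewrite lt_min r_gt0 ltr01.
move=> B BV cB; apply: (@compact_nrm _ _ _ S _ _ (C + L * nrm abs A)).
  by apply: polymap_preimage_closed; [exact: g_polymap|exact: compact_closed_nrm].
move=> y /= /BV; rewrite /= lt_min => /andP[yr y1].
have [x1 fx1 Hx1] := H_onto yr.
have cr : nrm abs (c - c) < r by rewrite subrr nrm0.
have [_ /(_ c cr)] := H_section fx1 yr.
have [fx2 _] := H_section fx1 cr.
rewrite Hx1 => h.
have -> : y = H x1 c *m A + (y *m Ai - H x1 c) *m A.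
  by rewrite -mulmxDl addrC subrK -mulmxA AiA mulmx1.
apply: le_trans (nrmD _ _) _; apply: lerD; first exact: X_bounded.
apply: le_trans (nrmM _ _) _; rewrite ler_wpM2r // (le_trans h) //.
by rewrite ler_piMr // ltW.
Qed.

(** A covector killing the image of the differential would be seen to first
    order along the Lipschitz section through the point, but the section moves
    g only to second order in its direction. *)
Lemma g_regular : regular_value g c.
Proof.
have [D gD DB] := hadamard (S := S) g_polymap.
move=> y0 gy0; have dg := diff_hadamard gD DB y0.
suff : row_full (D (y0, y0)).
  move=> /row_fullP[Ji JiJ] w; exists (w *m Ji).
  by rewrite dg -mulmxA JiJ mulmx1.
apply: contraT; rewrite /row_full -mxrank_tr -/(row_free _) => Jfree.
have [v vJ v0] : exists2 v : 'rV[K]_p, v *m (D (y0, y0))^T = 0 & v != 0.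
  have : kermx (D (y0, y0))^T != 0 by rewrite kermx_eq0.
  by move=> /rowV0Pn[v /sub_kermxP vM v0]; exists v.
have {vJ} Je : D (y0, y0) *m v^T = 0.
  by apply: (can_inj trmxK); rewrite trmx_mul trmxK vJ trmx0.
have [l vl] : exists l, v 0 l != 0.
  apply/existsP; apply: contraNT v0; rewrite negb_exists => /forallP v0.
  by apply/eqP/rowP => l; rewrite mxE; apply/eqP; rewrite -[_ == _]negbK.
pose w : 'rV[K]_p := (v 0 l)^-1 *: delta_mx 0 l.
have we : w *m v^T = 1%:M.
  rewrite -scalemxAl -rowE; apply/matrixP => i j; rewrite !ord1 !mxE.
  by rewrite mulVf.
have fx : f (y0 *m Ai) = c by [].
have cr : nrm abs (f (y0 *m Ai) - c) < r by rewrite fx subrr nrm0.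
have [x1 fx1 Hx1] := H_onto cr; rewrite fx in Hx1.
pose s t := H x1 t *m A.
have L'0 : 0 <= L * nrm abs A by rewrite mulr_ge0 // ltW.
have sc : s c = y0 by rewrite /s Hx1 -mulmxA AiA mulmx1.
have gs t : nrm abs (t - c) < r -> g (s t) = t.
  by move=> tr; rewrite /s -f_factor; have [] := H_section fx1 tr.
have sL t : nrm abs (t - c) < r -> nrm abs (s t - y0) <= L * nrm abs A * nrm abs (t - c).
  move=> tr; rewrite -sc -mulmxBl; apply: le_trans (nrmM _ _) _.
  rewrite mulrAC ler_wpM2r //; have [_] := H_section fx1 tr; apply.
  by rewrite subrr nrm0.
pose L' := L * nrm abs A * nrm abs w.
have L'' : 0 <= L' by rewrite mulr_ge0.
have rho0 : 0 < nrm abs y0 + L' + 1 by rewrite ltr_wpDl // addr_ge0.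
have [E E0 DE] := DB _ rho0.
pose Q := L' * (E * L') * nrm abs v^T.
have Q0 : 0 <= Q by rewrite !mulr_ge0 // ltW.
have key u : 0 < u -> u <= 1 -> u * nrm abs w < r -> u <= Q * u ^+ 2.
  move=> u0 u1 ur; pose t := c + emb S u *: w.
  have tc : t - c = emb S u *: w by rewrite /t addrC addKr.
  have ntc : nrm abs (t - c) = u * nrm abs w by rewrite tc nrmZ abs_emb gtr0_norm.
  have tr : nrm abs (t - c) < r by rewrite ntc.
  have st : nrm abs (s t - y0) <= L' * u.
    have -> : L' * u = L * nrm abs A * (u * nrm abs w) by rewrite /L'; ring.
    by rewrite -ntc; exact: sL.
  have st1 : nrm abs (s t) <= nrm abs y0 + L' + 1.
    have := nrmD (S := S) (s t - y0) y0; rewrite subrK.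
    have : L' * u <= L' by rewrite ler_piMr.
    lra.
  have uE : emb S u *: 1%:M = (s t - y0) *m (D (s t, y0) - D (y0, y0)) *m v^T.
    rewrite mulmxBr mulmxBl -gD (gs _ tr) gy0 -(mulmxA _ (D (y0, y0))) Je mulmx0 subr0.
    by rewrite tc -scalemxAl we.
  have -> : u = nrm abs (emb S u *: (1%:M : 'M[K]_1)).
    by rewrite nrmZ nrm_row big_ord1 mxE abs1 mulr1 abs_emb gtr0_norm.
  rewrite {1}uE; apply: le_trans (nrmM _ _) _.
  have -> : Q * nrm abs (emb S u *: (1%:M : 'M[K]_1)) ^+ 2 =
      (L' * u) * (E * (L' * u)) * nrm abs v^T.
    rewrite nrmZ nrm_row big_ord1 mxE abs1 mulr1 abs_emb gtr0_norm // /Q.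
    ring.
  rewrite ler_wpM2r //; apply: le_trans (nrmM _ _) _; apply: ler_pM => //.
  have [||_] := DE (s t, y0) (y0, y0).
  - by split; rewrite /nball /=; lra.
  - by split; rewrite /nball /=; lra.
  rewrite /dist2 /= subrr nrm0 addr0 => /le_trans; apply.
  by rewrite ler_pM2l.
(* u <= Q u^2 fails for 0 < u < 1 / Q. *)
pose u := Num.min (Num.min 1 (r / (nrm abs w + 1))) (1 / (2 * (Q + 1))).
have w1 : 0 < nrm abs w + 1 by rewrite ltr_wpDl.
have Q1 : 0 < 2 * (Q + 1) by rewrite mulr_gt0 // ltr_wpDl.
have u0 : 0 < u by rewrite !lt_min ltr01 !divr_gt0.
have u1 : u <= 1 by rewrite !ge_min lexx.
have ur : u <= r / (nrm abs w + 1) by rewrite !ge_min lexx orbT.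
have uQ : u <= 1 / (2 * (Q + 1)) by rewrite ge_min lexx orbT.
have := key u u0 u1; move: ur uQ; rewrite !ler_pdivlMr // => ur uQ.
have -> : u * nrm abs w < r.
  by apply: lt_le_trans ur; rewrite ltr_pM2l // ltrDl.
move=> /(_ isT); rewrite expr2 mulrA -[X in X <= _]mul1r ler_pM2r //.
nra.
Qed.

End TrivialImpliesFactorisation.

(** * A right inverse of the differential near a compact fibre *)

Section RightInverse.
Context (R : realType) (K : numFieldType) (abs : K -> R) {S : scalars abs}.
Let nrm_pos m n (A : 'M[K]_(m, n)) : 0 <= nrm abs A.
Proof. exact: nrm_ge0. Qed.
Let abs_pos (x : K) : 0 <= abs x.
Proof. exact: abs_ge0. Qed.
Hint Resolve nrm_pos abs_pos : core.

Lemma cjK x : cj S (cj S x) = x.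
Proof.
have [->|x0] := eqVneq x 0; first by rewrite !rmorph0.
have cx0 : cj S x != 0 by rewrite -(abs_eq0 (abs := abs)) abs_cj abs_eq0.
apply: (mulfI cx0); rewrite cjE normE abs_cj -normE -cjE.
exact: mulrC.
Qed.

Definition adjoint_mx m n (A : 'M[K]_(m, n)) := (map_mx (cj S) A)^T.

Lemma adjoint_mxM m n p (A : 'M[K]_(m, n)) (B : 'M[K]_(n, p)) :
  adjoint_mx (A *m B) = adjoint_mx B *m adjoint_mx A.
Proof. by rewrite /adjoint_mx map_mxM trmx_mul. Qed.

Lemma adjoint_mxK m n (A : 'M[K]_(m, n)) : adjoint_mx (adjoint_mx A) = A.
Proof. by apply/matrixP => i j; rewrite !mxE cjK. Qed.

(** If v J* J = 0 then u = v J* satisfies u u* = 0, so u = 0 and v = 0. *)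
Lemma gram_det_neq0 m p (J : 'M[K]_(m, p)) :
  row_full J -> \det (adjoint_mx J *m J) != 0.
Proof.
move=> Jfull; apply/negP => /det0P[v v0]; rewrite mulmxA => vJ.
pose u := v *m adjoint_mx J.
have uu : u *m adjoint_mx u = 0.
  by rewrite {2}/u adjoint_mxM adjoint_mxK mulmxA vJ mul0mx.
have u0 : u = 0.
  apply/rowP => i; rewrite [RHS]mxE; apply/eqP.
  move/matrixP/(_ 0 0): uu; rewrite !mxE => /eqP.
  rewrite psumr_eq0.
    move=> /allP /(_ i); rewrite mem_index_enum !mxE => /(_ isT).
    by rewrite cjE sqrf_eq0 normr_eq0.
  by move=> j _; rewrite !mxE cjE exprn_ge0.
have Jfree : row_free (adjoint_mx J).
  by rewrite /row_free mxrank_tr mxrank_map.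
move/negP: v0; apply; apply/eqP; apply: (row_free_inj Jfree).
by rewrite mul0mx.
Qed.

Variables (m p : nat) (g : 'rV[K]_m -> 'rV[K]_p) (c : 'rV[K]_p).
Hypothesis g_poly : polymap g.

Lemma proper_fibre_compact : proper_at g c -> compact (g @^-1` [set c]).
Proof.
move=> [V [cV gV]]; apply: gV; last exact: compact_set1.
by move=> _ ->; apply: nbhs_singleton.
Qed.

(** On the part of a compact preimage that is at distance at least d from the
    fibre, |g - c| has a positive minimum. *)
Lemma near_fibre d : proper_at g c -> 0 < d ->
  exists2 e, 0 < e & forall y, nrm abs (g y - c) < e ->
    exists2 a, g a = c & nrm abs (y - a) < d.
Proof.
move=> [V [/nbhs_nrm[e0 e00 eV] gV]] d0.
pose B := [set t | nrm abs (t - c) <= e0 / 2].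
have cB : compact (g @^-1` B).
  apply: gV; last exact: nrm_ball_compact.
  by move=> t /= tB; apply: eV; apply: le_lt_trans tB _; lra.
pose far := [set y | nrm abs (g y - c) <= e0 / 2 /\
  forall a, g a = c -> d <= nrm abs (y - a)].
have clB := compact_closed_nrm cB.
have cF : compact far.
  apply: subclosed_compact cB _ => [|y [] //].
  apply: (closed_nrm (S := S)) => y ycl; split.
    apply: (closedP_nrm (S := S) clB).
    by move=> e /ycl[v [vB _] vy]; exists v.
  move=> a ga; apply/ler_addgt0Pr => e /ycl[v [_ /(_ a ga) va] vy].
  by have := nrm_triangle (S := S) v y a; lra.
have [F0|F0] := pselect (far !=set0); last first.
  exists (e0 / 2); first lra.
  move=> y ye; apply: contrapT => ya; apply: F0; exists y; split; first exact: ltW.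
  by move=> a ga; rewrite leNgt; apply/negP => yad; apply: ya; exists a.
have [r r0 Fr] := compact_nrm_bounded (S := S) cF.
have [C C0 gC] := polymap_blip (S := S) r0 g_poly.
have [|y [yB yfar] ymin] := compact_min (S := S) (f := fun y => nrm abs (g y - c)) F0 cF.
  move=> u e Fu e1; exists (e / C); first by rewrite divr_gt0.
  move=> v Fv vu; have [_ guv] := gC u v (Fr u Fu) (Fr v Fv).
  have : C * dist1 abs u v < e by rewrite /dist1 nrmBC mulrC -ltr_pdivlMr.
  have := nrm_triangle (S := S) (g u) (g v) c; have := nrm_triangle (S := S) (g v) (g u) c.
  by rewrite (nrmBC (g v) (g u)) ltr_norml => *; apply/andP; split; lra.
have y0 : 0 < nrm abs (g y - c).
  rewrite lt_def nrm_pos andbT; apply/eqP => gy.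
  have /yfar : g y = c.
    by apply/eqP; rewrite -subr_eq0; apply/eqP/(nrm_le0 (S := S)); rewrite gy.
  by rewrite subrr nrm0 leNgt d0.
exists (Num.min (e0 / 2) (nrm abs (g y - c))); first by rewrite lt_min y0 andbT; lra.
move=> z; rewrite lt_min => /andP[ze zy]; apply: contrapT => za.
have : far z.
  split; first exact: ltW.
  by move=> a ga; rewrite leNgt; apply/negP => yad; apply: za; exists a.
by move=> /ymin; rewrite leNgt zy.
Qed.

Variable D : 'rV[K]_m * 'rV[K]_m -> 'M[K]_(m, p).
Hypothesis gD : forall y z, g y - g z = (y - z) *m D (y, z).
Hypothesis D_blip : forall r, 0 < r ->
  blip abs (@dist2 _ _ abs m m) (@nball _ _ abs m r `*` @nball _ _ abs m r) D.

Definition tube d : set 'rV[K]_m := [set x | exists2 a, g a = c & nrm abs (x - a) <= d].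

(** With J the Jacobian, B = (J* J)^-1 J*.  The determinant of J* J is bounded
    below on the compact fibre, hence on a tube around it, where the formula with
    the adjugate shows that B is bounded and Lipschitz. *)
Lemma right_inverse : proper_at g c -> regular_value g c ->
  exists (r d : R) (B : 'rV[K]_m -> 'M[K]_(p, m)), [/\ 0 < r, 0 < d,
    tube d `<=` nball abs r,
    forall x, tube d x -> B x *m D (x, x) = 1%:M
    & blip abs (@dist1 _ _ abs m) (tube d) B].
Proof.
move=> gprop greg; have cM := proper_fibre_compact gprop.
have [r r0 Mr] := compact_nrm_bounded (S := S) cM.
pose r1 := r + 1.
have r10 : 0 < r1 by rewrite addr_gt0.
pose J x := D (x, x).
have dge0 := @dist1_ge0 _ _ abs S m.
have J_blip : blip abs (@dist1 _ _ abs m) (nball abs r1) J.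
  rewrite -[J]/(D \o (fun x => (x, x))).
  apply: (blip_comp (c := 2) _ _ _ _ (D_blip r10)) => //.
  by move=> u v _ _; rewrite /dist2 /= mulr2n mulrDl mul1r.
pose A x := adjoint_mx (J x) *m J x.
have A_blip : blip abs (@dist1 _ _ abs m) (nball abs r1) A.
  by apply: blipM => //; apply: blip_adjoint.
pose det x := \det (A x).
have [C C0 detC] : blip1 abs (@dist1 _ _ abs m) (nball abs r1) det by apply: blip1_det.
have Min x : g x = c -> nball abs r1 x.
  by move=> /Mr; rewrite /nball /= /r1; lra.
have det0 x : g x = c -> det x != 0.
  move=> gx; apply: gram_det_neq0; apply/row_fullP.
  have Jw (w : 'rV[K]_p) : exists v, v *m J x = w.
    have [v <-] := greg x gx w; exists v.
    by rewrite (diff_hadamard gD D_blip).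
  have [Ji JiP] := choice (fun i : 'I_p => Jw (row i 1%:M)).
  exists (\matrix_i Ji i); apply/row_matrixP => i.
  by rewrite row_mul rowK JiP.
have [eta eta0 detM] : exists2 eta, 0 < eta & forall x, g x = c -> eta <= abs (det x).
  have [M0|M0] := pselect (g @^-1` [set c] !=set0); last first.
    by exists 1 => // x gx; case: M0; exists x.
  have [|y gy ymin] := compact_min (S := S) (f := fun y => abs (det y)) M0 cM.
    move=> u e gu e0; exists (e / C); first by rewrite divr_gt0.
    move=> v gv vu; have [_ duv] := detC u v (Min u gu) (Min v gv).
    have : C * dist1 abs u v < e by rewrite /dist1 nrmBC mulrC -ltr_pdivlMr.
    have := absD (S := S) (det u - det v) (det v).
    have := absD (S := S) (det v - det u) (det u).
    by rewrite !subrK (absBC (det v)) ltr_norml => *; apply/andP; split; lra.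
  exists (abs (det y)); last by move=> x gx; apply: ymin.
  by rewrite lt_def abs_pos abs_eq0 det0.
pose d := Num.min 1 (eta / (2 * C)).
have d0 : 0 < d by rewrite lt_min ltr01 divr_gt0 // mulr_gt0.
have [d1 dC] : d <= 1 /\ d <= eta / (2 * C) by rewrite !ge_min !lexx orbT.
have tube_ball : tube d `<=` nball abs r1.
  move=> x [a /Mr ar xa]; rewrite /nball /=.
  by have := nrmD (S := S) (x - a) a; rewrite subrK /r1; lra.
have detU x : tube d x -> eta / 2 <= abs (det x).
  move=> Ux; have [a ga xa] := Ux.
  have [_ dxa] := detC a x (Min a ga) (tube_ball x Ux).
  have : C * dist1 abs a x <= eta / 2.
    rewrite /dist1 nrmBC mulrC -ler_pdivlMr //; apply: le_trans xa _.
    by rewrite -mulrA -invfM.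
  have := absD (S := S) (det a - det x) (det x); rewrite subrK.
  by have := detM a ga; lra.
exists r1, d, (fun x => (det x)^-1 *: \adj (A x) *m adjoint_mx (J x)); split=> //.
  move=> x Ux; rewrite -!scalemxAl -mulmxA mul_adj_mx -mul_scalar_mx -scalar_mxM.
  rewrite mulVf // -(abs_eq0 (abs := abs)).
  by have := detU x Ux; case: eqP => // ->; lra.
apply: blipM => //; last by apply: blip_sub tube_ball _; apply: blip_adjoint.
apply: blipZ => //.
  have eta2 : 0 < eta / 2 by lra.
  apply: (blip1V dge0 eta2 detU).
  have [E E0 detE] : blip1 abs (@dist1 _ _ abs m) (nball abs r1) det by apply: blip1_det.
  by exists E => // u v /tube_ball Du /tube_ball Dv; apply: detE.
by apply: blip_sub tube_ball _; apply: blip_adj.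
Qed.

End RightInverse.

(** * Trivialisation of a tube around the fibre *)

Section TubularTrivialisation.
Context (R : realType) (K : numFieldType) (abs : K -> R) {S : scalars abs}.
Let nrm_pos m n (A : 'M[K]_(m, n)) : 0 <= nrm abs A.
Proof. exact: nrm_ge0. Qed.
Let abs_pos (x : K) : 0 <= abs x.
Proof. exact: abs_ge0. Qed.
Hint Resolve nrm_pos abs_pos : core.

Variables (m p : nat) (g : 'rV[K]_m -> 'rV[K]_p) (c : 'rV[K]_p).
Variable D : 'rV[K]_m * 'rV[K]_m -> 'M[K]_(m, p).
Hypothesis gD : forall y z, g y - g z = (y - z) *m D (y, z).
Hypothesis D_blip : forall r, 0 < r ->
  blip abs (@dist2 _ _ abs m m) (@nball _ _ abs m r `*` @nball _ _ abs m r) D.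
Variables (rho d : R) (B : 'rV[K]_m -> 'M[K]_(p, m)).
Hypothesis rho_gt0 : 0 < rho.
Hypothesis d_gt0 : 0 < d.
Hypothesis tube_ball : tube abs g c d `<=` nball abs rho.
Hypothesis BJ : forall x, tube abs g c d x -> B x *m D (x, x) = 1%:M.
Hypothesis B_blip : blip abs (@dist1 _ _ abs m) (tube abs g c d) B.

Let U := tube abs g c d.

(** The relative error of the first-order expansion of g between
    y and y - s B(x): by the lemma newton_error it is the factor G in
    g y - g (y - s B(x)) = s + s G. *)
Definition newton_factor x s y := B x *m (D (y, y - s *m B x) - D (x, x)).

Lemma newton_error x s y : U x ->
  g y - g (y - s *m B x) = s + s *m newton_factor x s y.
Proof.
move=> Ux; rewrite gD subKr /newton_factor mulmxBr (BJ Ux).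
by rewrite mulmxBr mulmx1 [RHS]addrC subrK mulmxA.
Qed.

(** All ingredients are bounded and Lipschitz in the triple (x, s, y). *)
Lemma newton_factor_lipschitz : exists CB CG, [/\ 0 < CB, 0 < CG,
  forall x, U x -> nrm abs (B x) <= CB,
  forall x x', U x -> U x' -> nrm abs (B x - B x') <= CB * nrm abs (x - x') &
  forall x s y x' s' y', U x -> U x' -> nrm abs s <= 1 -> nrm abs s' <= 1 ->
    nrm abs y <= rho + CB -> nrm abs y' <= rho + CB ->
    nrm abs (newton_factor x s y - newton_factor x' s' y') <=
      CG * (nrm abs (x - x') + nrm abs (s - s') + nrm abs (y - y'))].
Proof.
have [CB CB0 BC] := B_blip.
pose T := (('rV[K]_m * 'rV[K]_p) * 'rV[K]_m)%type.
pose dT (u v : T) := dist2 abs u.1 v.1 + nrm abs (u.2 - v.2).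
pose DT : set T := [set u | [/\ U u.1.1, nrm abs u.1.2 <= 1 & nrm abs u.2 <= rho + CB]].
have dT0 u v : 0 <= dT u v by rewrite addr_ge0 // dist2_ge0.
have d1T u v : nrm abs (u.1.1 - v.1.1) <= 1 * dT u v.
  by rewrite mul1r /dT /dist2 -addrA lerDl addr_ge0.
have d2T u v : nrm abs (u.1.2 - v.1.2) <= 1 * dT u v.
  by rewrite mul1r /dT /dist2 (addrC (nrm _ _)) -addrA lerDl addr_ge0.
have d3T u v : nrm abs (u.2 - v.2) <= 1 * dT u v.
  by rewrite mul1r /dT lerDr dist2_ge0.
have B_bl : blip abs dT DT (B \o (fun u => u.1.1)).
  by apply: (blip_comp (c := 1) _ _ _ _ B_blip) => // [u []|u v _ _] //; exact: d1T.
have s_bl : blip abs dT DT (id \o (fun u => u.1.2)).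
  apply: (blip_comp (c := 1) _ _ _ _ (blip_id (S := S) p ltr01)) => // [u []|u v _ _] //.
  exact: d2T.
have r10 : 0 < rho + CB by rewrite addr_gt0.
have y_bl : blip abs dT DT (id \o (fun u => u.2)).
  apply: (blip_comp (c := 1) _ _ _ _ (blip_id (S := S) m r10)) => // [u []|u v _ _] //.
  exact: d3T.
have z_bl : blip abs dT DT (fun u => u.2 - u.1.2 *m B u.1.1).
  by apply: blipB => //; apply: blipM.
have [Cz Cz0 zC] := z_bl.
have r20 : 0 < rho + CB + Cz by rewrite addr_gt0.
have D1_bl : blip abs dT DT (D \o (fun u => (u.2, u.2 - u.1.2 *m B u.1.1))).
  apply: (blip_comp (c := 1 + Cz) _ _ _ _ (D_blip r20)) => //.
  - by rewrite addr_gt0.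
  - move=> u Du; have [zu _] := zC u u Du Du; have [_ _ yu] := Du.
    split; rewrite /nball /=; first by apply: le_trans yu _; rewrite lerDl ltW.
    by apply: le_trans zu _; rewrite lerDr ltW.
  - move=> u v Du Dv; have [_ zuv] := zC u v Du Dv.
    by rewrite /dist2 /= mulrDl lerD // d3T.
have D2_bl : blip abs dT DT (D \o (fun u => (u.1.1, u.1.1))).
  apply: (blip_comp (c := 2) _ _ _ _ (D_blip rho_gt0)) => //.
  - by move=> u [/tube_ball].
  - by move=> u v _ _; rewrite /dist2 /= mulr2n mulrDl lerD // d1T.
have G_bl : blip abs dT DT (fun u => newton_factor u.1.1 u.1.2 u.2).
  by apply: blipM => //; apply: blipB.
have [CG CG0 GC] := G_bl.
exists CB, CG; split=> //.
- by move=> x Ux; have [] := BC x x Ux Ux.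
- by move=> x x' Ux Ux'; have [] := BC x x' Ux Ux'.
move=> x s y x' s' y' Ux Ux' s1 s1' yr yr'.
by have [_] := GC (x, s, y) (x', s', y') (And3 Ux s1 yr) (And3 Ux' s1' yr').
Qed.

Variables (CB CG : R).
Hypothesis CB_gt0 : 0 < CB.
Hypothesis CG_gt0 : 0 < CG.
Hypothesis B_le : forall x, U x -> nrm abs (B x) <= CB.
Hypothesis B_lip : forall x x', U x -> U x' ->
  nrm abs (B x - B x') <= CB * nrm abs (x - x').
Hypothesis G_lip : forall x s y x' s' y', U x -> U x' ->
  nrm abs s <= 1 -> nrm abs s' <= 1 ->
  nrm abs y <= rho + CB -> nrm abs y' <= rho + CB ->
  nrm abs (newton_factor x s y - newton_factor x' s' y') <=
    CG * (nrm abs (x - x') + nrm abs (s - s') + nrm abs (y - y')).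

Lemma fibre_tube x : g x = c -> U x.
Proof. by move=> gx; exists x => //; rewrite subrr nrm0 ltW. Qed.

(** The factor vanishes at (x, 0, x). *)
Lemma newton_factor_le x s y : U x -> nrm abs s <= 1 -> nrm abs y <= rho + CB ->
  nrm abs (newton_factor x s y) <= CG * (nrm abs s + nrm abs (y - x)).
Proof.
move=> Ux s1 yr; have xr : nrm abs x <= rho + CB.
  by apply: le_trans (tube_ball Ux) _; rewrite lerDl ltW.
have := G_lip Ux Ux s1 _ yr xr; move=> /(_ 0); rewrite nrm0 => /(_ ler01).
rewrite {2}/newton_factor mul0mx subr0 subrr mulmx0 !subr0 subrr nrm0 add0r.
exact.
Qed.

Lemma sB_lipschitz x x' (s s' : 'rV[K]_p) : U x -> U x' ->
  nrm abs (s *m B x - s' *m B x') <=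
    nrm abs (s - s') * CB + nrm abs s' * (CB * nrm abs (x - x')).
Proof.
move=> Ux Ux'.
have -> : s *m B x - s' *m B x' = (s - s') *m B x + s' *m (B x - B x').
  by rewrite mulmxBl mulmxBr addrA subrK.
apply: le_trans (nrmD _ _) _; apply: lerD; apply: le_trans (nrmM _ _) _.
  by rewrite ler_wpM2l // B_le.
by rewrite ler_wpM2l // B_lip.
Qed.

Variable r : R.
Hypothesis r_gt0 : 0 < r.
Hypothesis r_le1 : r <= 1.
Hypothesis r_le_d : r <= d.
(* kappa r is the Lipschitz constant of the error on the ball of radius r.  The
   three conditions on r make, in turn, the equation for s a contraction, the
   lower Lipschitz bound hold, and the iteration for (x, s) a contraction. *)
Let kappa := CG * (3 + 2 * CB).
Hypothesis r_contract : r * kappa <= 1 / 4.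
Hypothesis r_lower : r * (2 * kappa * CB + CB) <= 1 / 4.
Hypothesis r_onto : r * ((1 + CB) * (4 * CG) + CB * (1 + 3 * CG)) <= 1 / 4.

Let param x (s : 'rV[K]_p) := x + s *m B x.
Let err x s := s *m newton_factor x s (param x s).

Lemma g_param x s : g x = c -> g (param x s) = c + s + err x s.
Proof.
move=> gx; have := newton_error s (param x s) (fibre_tube gx).
by rewrite {2}/param addrK gx => /(canRL (subrK _)) ->; rewrite addrC addrA.
Qed.

Lemma param_ball x s : g x = c -> nrm abs s <= r -> nrm abs (param x s) <= rho + CB.
Proof.
move=> gx sr; have Ux := fibre_tube gx.
apply: le_trans (nrmD _ _) _; apply: lerD; first exact: (tube_ball Ux).
apply: le_trans (nrmM _ _) _; rewrite -[leRHS]mul1r; apply: ler_pM => //.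
  exact: le_trans sr r_le1.
exact: B_le.
Qed.

(** The error is s times a factor of size O(|s|), so its Lipschitz constant is
    O(r). *)
Lemma err_lipschitz x x' s s' : g x = c -> g x' = c ->
  nrm abs s <= r -> nrm abs s' <= r ->
  nrm abs (err x s - err x' s') <=
    r * kappa * (nrm abs (x - x') + nrm abs (s - s')).
Proof.
move=> gx gx' sr sr'; have Ux := fibre_tube gx; have Ux' := fibre_tube gx'.
have r1 := r_le1; have r0 := ltW r_gt0; have CB0 := ltW CB_gt0; have CG0 := ltW CG_gt0.
have s1 : nrm abs s <= 1 by exact: le_trans sr r_le1.
have s1' : nrm abs s' <= 1 by exact: le_trans sr' r_le1.
set a := nrm abs (x - x'); set b := nrm abs (s - s').
have a0 : 0 <= a by exact: nrm_pos. have b0 : 0 <= b by exact: nrm_pos.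
have -> : err x s - err x' s' = (s - s') *m newton_factor x s (param x s) +
    s' *m (newton_factor x s (param x s) - newton_factor x' s' (param x' s')).
  by rewrite mulmxBl mulmxBr addrA subrK.
apply: le_trans (nrmD _ _) _.
have h1 : nrm abs ((s - s') *m newton_factor x s (param x s)) <= b * (CG * (r + r * CB)).
  apply: le_trans (nrmM _ _) _; rewrite ler_wpM2l //.
  apply: le_trans (newton_factor_le Ux s1 (param_ball gx sr)) _.
  rewrite ler_wpM2l // lerD // /param addrC addKr.
  by apply: le_trans (nrmM _ _) _; apply: ler_pM => //; apply: B_le.
have e : nrm abs (param x s - param x' s') <= a + CB * (a + b).
  rewrite /param opprD addrACA; apply: le_trans (nrmD _ _) _; rewrite lerD2l.
  apply: le_trans (sB_lipschitz _ _ Ux Ux') _.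
  rewrite -/a -/b mulrDr addrC lerD //; last by rewrite mulrC.
  by rewrite ler_piMl // mulr_ge0.
have h2 : nrm abs (s' *m (newton_factor x s (param x s) - newton_factor x' s' (param x' s')))
    <= r * (CG * (a + b + (a + CB * (a + b)))).
  apply: le_trans (nrmM _ _) _; apply: ler_pM => //.
  apply: le_trans (G_lip Ux Ux' s1 s1' (param_ball gx sr) (param_ball gx' sr')) _.
  by rewrite ler_wpM2l // lerD2l.
apply: le_trans (lerD h1 h2) _.
have p1 : 0 <= r * CG * a by rewrite !mulr_ge0.
have p2 : 0 <= r * CG * b by rewrite !mulr_ge0.
have p3 : 0 <= r * CG * CB * a by rewrite !mulr_ge0.
rewrite /kappa; lra.
Qed.

(** Solve s = (t - c) - err x s. *)
Lemma param_onto_values x t : g x = c -> nrm abs (t - c) <= r / 2 ->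
  exists2 s, nrm abs s <= r & g (param x s) = t.
Proof.
move=> gx tr; have rk := r_contract.
have [||s sr sE] := contraction_fixpoint (S := S) (T := fun s => (t - c) - err x s)
    (a := 0) r_gt0.
- move=> s s'; rewrite !subr0 => sr sr'.
  rewrite opprB addrC addrA subrK.
  have := err_lipschitz gx gx sr' sr; rewrite subrr nrm0 add0r (nrmBC s') => h.
  apply: le_trans h _; rewrite mulrC ler_wpM2l //; lra.
- by rewrite subr0 /err mul0mx subr0.
exists s; first by rewrite subr0 in sr.
by rewrite (g_param s gx) -[X in c + X + _]sE -addrA subrK addrC subrK.
Qed.

(** Subtracting g(param x s) = c + s + err x s at two points controls s by the
    values of g, up to a small multiple of |x - x'|; the definition of param then
    controls x by the points and the values. *)
Lemma param_lipschitz x x' s s' : g x = c -> g x' = c ->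
  nrm abs s <= r -> nrm abs s' <= r ->
  [/\ nrm abs (s - s') <= 2 * nrm abs (g (param x s) - g (param x' s'))
        + 2 * (r * kappa) * nrm abs (x - x'),
      nrm abs (param x s - param x' s') <=
        (1 + CB) * (nrm abs (x - x') + nrm abs (s - s')) &
      nrm abs (x - x') <= 2 * nrm abs (param x s - param x' s')
        + 4 * CB * nrm abs (g (param x s) - g (param x' s'))].
Proof.
move=> gx gx' sr sr'; have Ux := fibre_tube gx; have Ux' := fibre_tube gx'.
have r1 := r_le1; have r0 := ltW r_gt0; have CB0 := ltW CB_gt0; have CG0 := ltW CG_gt0.
have rk := r_contract; have rl := r_lower.
set a := nrm abs (x - x'); set b := nrm abs (s - s').
set e := nrm abs (param x s - _); set t := nrm abs (g _ - _).
have a0 : 0 <= a by exact: nrm_pos.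
have b0 : 0 <= b by exact: nrm_pos.
have t0 : 0 <= t by exact: nrm_pos.
have k0 : 0 <= kappa by rewrite mulr_ge0 // addr_ge0 // mulr_ge0.
have hb : b <= t + r * kappa * (a + b).
  have sE : s - s' = (g (param x s) - g (param x' s')) - (err x s - err x' s').
    rewrite (g_param s gx) (g_param s' gx').
    set E := err x s; set E' := err x' s'.
    by apply/rowP => j; rewrite !mxE; ring.
  apply: (@le_trans _ _ (t + nrm abs (err x s - err x' s'))).
    by rewrite /b sE; exact: nrmB.
  by rewrite lerD2l; exact: err_lipschitz.
have hb' : b <= 2 * t + 2 * (r * kappa) * a.
  have : r * kappa * b <= 1 / 4 * b by rewrite ler_wpM2r.
  have := mulr_ge0 (mulr_ge0 r0 k0) a0.
  by move: hb; rewrite mulrDr; lra.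
have hs : nrm abs (s *m B x - s' *m B x') <= b * CB + r * (CB * a).
  apply: le_trans (sB_lipschitz _ _ Ux Ux') _; rewrite lerD2l ler_wpM2r //.
  by rewrite mulr_ge0.
have pE : param x s - param x' s' = (x - x') + (s *m B x - s' *m B x').
  by rewrite /param opprD addrACA.
split=> //.
  rewrite /e pE; apply: le_trans (nrmD _ _) _; rewrite -/a.
  have : r * (CB * a) <= CB * a by rewrite ler_piMl // mulr_ge0.
  have := mulr_ge0 CB0 b0; lra.
have ae : a <= e + nrm abs (s *m B x - s' *m B x').
  have -> : a = nrm abs ((param x s - param x' s') - (s *m B x - s' *m B x')).
    by rewrite pE addrK.
  exact: nrmB.
have bc : b * CB <= (2 * t + 2 * (r * kappa) * a) * CB by rewrite ler_wpM2r.
have : r * (2 * kappa * CB + CB) * a <= 1 / 4 * a by rewrite ler_wpM2r.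
have : 0 <= e by exact: nrm_pos.
have := mulr_ge0 CB0 t0.
lra.
Qed.

(** Solve x = y - s B(x), s = (g y - c) - s G(x, s, y), where G is the Newton
    factor: by newton_error these say that y = param x s and g x = c.  The new
    value of s is used to update x; with this order the iteration is a contraction
    for the unweighted norm |x| + |s|, although B is not small. *)
Lemma param_onto_tube y a : g a = c -> nrm abs (y - a) <= r / 4 ->
  nrm abs (g y - c) <= r / (4 * (CB + 1)) ->
  exists x s, [/\ g x = c, nrm abs s <= r & y = param x s].
Proof.
move=> ga ya yc.
have r1 := r_le1; have r0 := ltW r_gt0; have CB0 := ltW CB_gt0; have CG0 := ltW CG_gt0.
have rp := r_gt0; have ro := r_onto; have rd := r_le_d.
have Ua := fibre_tube ga.
have Uy : U y by exists a => //; lra.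
have yr : nrm abs y <= rho + CB.
  by apply: le_trans (tube_ball Uy) _; rewrite lerDl ltW.
set t := nrm abs (g y - c) in yc.
have t0 : 0 <= t by exact: nrm_pos.
have tCB : t * CB + t <= r / 4.
  have : t * (4 * (CB + 1)) <= r by rewrite -ler_pdivlMr // mulr_gt0 // ltr_wpDl.
  lra.
have tr : t <= r by have := mulr_ge0 t0 CB0; lra.
pose next x s := (g y - c) - s *m newton_factor x s y.
pose T (u : 'rV[K]_(m + p)) : 'rV[K]_(m + p) :=
  row_mx (y - next (lsubmx u) (rsubmx u) *m B (lsubmx u)) (next (lsubmx u) (rsubmx u)).
have splitE (u v : 'rV[K]_(m + p)) :
    nrm abs (u - v) = nrm abs (lsubmx u - lsubmx v) + nrm abs (rsubmx u - rsubmx v).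
  by rewrite -{1}(hsubmxK u) -{1}(hsubmxK v) opp_row_mx add_row_mx nrm_row_mx.
have inball (u : 'rV[K]_(m + p)) : nrm abs (u - row_mx a 0) <= r ->
    [/\ U (lsubmx u), nrm abs (rsubmx u) <= r & nrm abs (lsubmx u - a) <= r].
  rewrite splitE row_mxKl row_mxKr subr0 => ur.
  have := nrm_pos (lsubmx u - a); have := nrm_pos (rsubmx u) => u1 u2.
  by split; [exists a => //| |]; lra.
have Gle x s : U x -> nrm abs s <= r -> nrm abs (x - a) <= r ->
    nrm abs (newton_factor x s y) <= 3 * r * CG.
  move=> Ux sr xa; apply: le_trans (newton_factor_le Ux (le_trans sr r1) yr) _.
  have : nrm abs (y - x) <= r / 4 + r.
    by apply: le_trans (nrm_triangle _ a _) _; rewrite (nrmBC a); lra.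
  move=> yx; rewrite mulrC ler_wpM2r //; lra.
have [||u ur uE] := contraction_fixpoint (S := S) (T := T) (a := row_mx a 0) r_gt0.
- move=> u v /inball[Ux sr xa] /inball[Ux' sr' xa'].
  rewrite !splitE /T !row_mxKl !row_mxKr.
  set x := lsubmx u in Ux xa *; set s := rsubmx u in sr *.
  set x' := lsubmx v in Ux' xa' *; set s' := rsubmx v in sr' *.
  set A := nrm abs (x - x'); set b := nrm abs (s - s').
  have A0 : 0 <= A by exact: nrm_pos. have b0 : 0 <= b by exact: nrm_pos.
  have hn : nrm abs (next x s - next x' s') <= 4 * r * CG * (A + b).
    have -> : next x s - next x' s' = - ((s - s') *m newton_factor x s y +
        s' *m (newton_factor x s y - newton_factor x' s' y)).
      rewrite /next; set G := newton_factor x s y; set G' := newton_factor x' s' y.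
      rewrite opprD addrACA subrr add0r opprK addrC.
      by rewrite mulmxBl mulmxBr addrA subrK opprB.
    rewrite nrmN; apply: le_trans (nrmD _ _) _.
    have h1 : nrm abs ((s - s') *m newton_factor x s y) <= b * (3 * r * CG).
      by apply: le_trans (nrmM _ _) _; rewrite ler_wpM2l // Gle.
    have h2 : nrm abs (s' *m (newton_factor x s y - newton_factor x' s' y))
        <= r * (CG * (A + b)).
      apply: le_trans (nrmM _ _) _; apply: ler_pM => //.
      apply: le_trans (G_lip Ux Ux' (le_trans sr r1) (le_trans sr' r1) yr yr) _.
      by rewrite subrr nrm0 addr0.
    have p1 : 0 <= r * CG * A by rewrite !mulr_ge0.
    by lra.
  have n' : nrm abs (next x' s') <= r * (1 + 3 * CG).
    apply: le_trans (nrmB _ _) _; rewrite -/t.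
    have : nrm abs (s' *m newton_factor x' s' y) <= r * (3 * r * CG).
      by apply: le_trans (nrmM _ _) _; apply: ler_pM => //; apply: Gle.
    have : r * (3 * r * CG) <= r * (3 * CG).
      by rewrite ler_wpM2l // ler_wpM2r // ler_piMr.
    lra.
  have hB : nrm abs (y - next x s *m B x - (y - next x' s' *m B x')) <=
      4 * r * CG * (A + b) * CB + r * (1 + 3 * CG) * (CB * A).
    have -> : y - next x s *m B x - (y - next x' s' *m B x') =
        - (next x s *m B x - next x' s' *m B x').
      by rewrite opprD addrACA subrr add0r opprK opprB addrC.
    rewrite nrmN; apply: le_trans (sB_lipschitz _ _ Ux Ux') _.
    by apply: lerD; rewrite ler_wpM2r // mulr_ge0.
  have h1 := mulr_ge0 (mulr_ge0 r0 CB0) b0.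
  have h2 := mulr_ge0 (mulr_ge0 (mulr_ge0 r0 CB0) CG0) b0.
  have h3 : r * ((1 + CB) * (4 * CG) + CB * (1 + 3 * CG)) * (A + b) <= 1 / 4 * (A + b).
    by rewrite ler_wpM2r // addr_ge0.
  lra.
- rewrite splitE /T !row_mxKl !row_mxKr /next mul0mx !subr0 -/t.
  have : nrm abs (y - (g y - c) *m B a - a) <= r / 4 + t * CB.
    rewrite addrAC; apply: le_trans (nrmB _ _) _; rewrite lerD //.
    by apply: le_trans (nrmM _ _) _; rewrite ler_wpM2l // B_le.
  lra.
have [Ux sr xa] := inball u ur.
set x := lsubmx u in Ux xa; set s := rsubmx u in sr.
have sE : s = next x s by rewrite {1}/s -uE /T row_mxKr.
have xE : x = y - s *m B x by rewrite {1}/x -uE /T row_mxKl -/x -/s -sE.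
exists x, s; split=> //; last by rewrite /param {1}xE subrK.
have := newton_error s y Ux; rewrite -xE => h.
have : g x = g y - (s + s *m newton_factor x s y) by rewrite -h opprB addrC subrK.
by move=> ->; rewrite {1}sE /next subrK opprB addrC subrK.
Qed.

End TubularTrivialisation.

(** * The characterisation *)

Section ProperImpliesTrivial.
Context (R : realType) (K : numFieldType) (abs : K -> R) {S : scalars abs}.
Let nrm_pos m n (A : 'M[K]_(m, n)) : 0 <= nrm abs A.
Proof. exact: nrm_ge0. Qed.
Hint Resolve nrm_pos : core.

(** The trivialisation sends (x, t) to x + s B(x), with s the unique small vector
    such that g takes the value t there. *)
Lemma proper_trivialisation m p (g : 'rV[K]_m -> 'rV[K]_p) (c : 'rV[K]_p) :
  polymap g -> proper_at g c -> regular_value g c ->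
  exists (e L : R) (h : 'rV[K]_m -> 'rV[K]_p -> 'rV[K]_m), [/\ 0 < e, 0 < L,
    forall x t, g x = c -> nrm abs (t - c) < e -> g (h x t) = t,
    forall y, nrm abs (g y - c) < e -> exists2 x, g x = c & h x (g y) = y &
    forall x x' t t', g x = c -> g x' = c ->
      nrm abs (t - c) < e -> nrm abs (t' - c) < e ->
      nrm abs (h x t - h x' t') <= L * (nrm abs (x - x') + nrm abs (t - t')) /\
      nrm abs (x - x') + nrm abs (t - t') <= L * nrm abs (h x t - h x' t')].
Proof.
move=> g_poly gprop greg.
have [D gD DB] := hadamard (S := S) g_poly.
have [rho [d [B [rho0 d0 tubeB BJ B_bl]]]] := right_inverse gD DB gprop greg.
have [CB [CG [CB0 CG0 B_le B_lip G_lip]]] :=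
  newton_factor_lipschitz DB rho0 tubeB B_bl.
pose kappa := CG * (3 + 2 * CB).
pose Z := kappa + (2 * kappa * CB + CB) + ((1 + CB) * (4 * CG) + CB * (1 + 3 * CG)).
have k0 : 0 < kappa by rewrite mulr_gt0 // addr_gt0 // mulr_gt0.
have z1 : 0 < 2 * kappa * CB + CB by have := mulr_gt0 k0 CB0; lra.
have z2 : 0 < (1 + CB) * (4 * CG) + CB * (1 + 3 * CG).
  have c1 : 0 < 1 + CB by lra.
  have c2 : 0 < 4 * CG by lra.
  have c3 : 0 < 1 + 3 * CG by lra.
  by rewrite addr_gt0 ?mulr_gt0.
have Z0 : 0 < Z by rewrite /Z; lra.
pose r := Num.min (Num.min 1 d) (1 / (4 * Z)).
have r0 : 0 < r by rewrite !lt_min ltr01 d0 divr_gt0 // mulr_gt0.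
have r1 : r <= 1 by rewrite !ge_min lexx.
have rd : r <= d by rewrite !ge_min lexx orbT.
have rZ : r * Z <= 1 / 4.
  have : r <= 1 / (4 * Z) by rewrite ge_min lexx orbT.
  by rewrite ler_pdivlMr ?mulr_gt0 //; lra.
have rle z : z <= Z -> r * z <= 1 / 4.
  by move=> zZ; apply: le_trans rZ; rewrite ler_pM2l.
have rk : r * kappa <= 1 / 4 by apply: rle; rewrite /Z; lra.
have rl : r * (2 * kappa * CB + CB) <= 1 / 4 by apply: rle; rewrite /Z; lra.
have ro : r * ((1 + CB) * (4 * CG) + CB * (1 + 3 * CG)) <= 1 / 4.
  by apply: rle; rewrite /Z; lra.
have r4 : 0 < r / 4 by lra.
have [e1 e10 near] := near_fibre (S := S) g_poly gprop r4.
pose e2 := r / (4 * (CB + 1)).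
have e20 : 0 < e2 by rewrite divr_gt0 // mulr_gt0 // addr_gt0.
have e2r : e2 <= r / 2.
  rewrite /e2 ler_pdivrMr; last by rewrite mulr_gt0 // addr_gt0.
  by have := mulr_gt0 r0 CB0; lra.
pose e := Num.min e1 e2.
have e0 : 0 < e by rewrite lt_min e10.
have ee1 : e <= e1 by rewrite /e ge_min lexx.
have ee2 : e <= e2 by rewrite /e ge_min lexx orbT.
pose sol x t s := nrm abs s <= r /\ g (x + s *m B x) = t.
have solP x t : exists s, g x = c -> nrm abs (t - c) < e -> sol x t s.
  have [gx|ngx] := pselect (g x = c); last by exists 0.
  have [te|nte] := boolP (nrm abs (t - c) < e); last by exists 0.
  have [|s sr sE] := param_onto_values gD d0 tubeB BJ CB0 CG0 B_le B_lip G_lip r0 r1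
      rk gx (t := t).
    by have := lt_le_trans te ee2; lra.
  by exists s.
have [s sP] := choice (fun xt : 'rV[K]_m * 'rV[K]_p => solP xt.1 xt.2).
pose h x t := x + s (x, t) *m B x.
have lip x x' t t' := param_lipschitz (S := S) gD d0 tubeB BJ CB0 CG0 B_le B_lip G_lip r0 r1
   rk rl (x := x) (x' := x') (s := t) (s' := t').
have near_ball x t : g x = c -> nrm abs (t - c) < e -> nball abs (rho + CB) (h x t).
  move=> gx te; have [sr _] := sP (x, t) gx te.
  exact: (param_ball d0 tubeB B_le r1 gx sr).
have rhoCB : 0 < rho + CB by rewrite addr_gt0.
have [Cg Cg0 gC] := polymap_blip (S := S) rhoCB g_poly.
pose L := (1 + CB) * 4 + (2 + 4 * CB * Cg) + Cg.
exists e, L, h.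
have L0 : 0 < L.
  by have := mulr_gt0 CB0 Cg0; rewrite /L; lra.
split=> //.
- by move=> x t gx te; have [] := sP (x, t) gx te.
- move=> y ye; have [a ga ya] := near y (lt_le_trans ye ee1).
  have ye2 : nrm abs (g y - c) <= e2 by exact: ltW (lt_le_trans ye ee2).
  have [x [s' [gx s'r yE]]] := param_onto_tube gD d0 tubeB BJ CB0 CG0 B_le B_lip G_lip
    r0 r1 rd ro ga (ltW ya) ye2.
  exists x => //; have [sr sE] := sP (x, g y) gx ye; rewrite /= in sE.
  have [+ _ _] := lip x x _ _ gx gx sr s'r.
  rewrite sE -yE subrr subrr !nrm0 !mulr0 addr0 => /nrm_le0 /subr0_eq ss'.
  by rewrite /h ss' -yE.
- move=> x x' t t' gx gx' te te'.
  have [sr sE] := sP (x, t) gx te; have [sr' sE'] := sP (x', t') gx' te'.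
  rewrite /= in sE sE'.
  have [b1 b2 b3] := lip x x' _ _ gx gx' sr sr'.
  rewrite sE sE' -/kappa -/(h x t) -/(h x' t') in b1 b2 b3.
  have [_] := gC _ _ (near_ball x t gx te) (near_ball x' t' gx' te').
  rewrite sE sE' /dist1 => b4.
  move: b1 b2 b3 b4.
  set a := nrm abs (x - x'); set b := nrm abs (t - t'); set q := nrm abs (h x t - h x' t').
  set v := nrm abs (s _ - _) => b1 b2 b3 b4.
  have a0 : 0 <= a by exact: nrm_pos. have b0 : 0 <= b by exact: nrm_pos.
  have q0 : 0 <= q by exact: nrm_pos. have v0 : 0 <= v by exact: nrm_pos.
  have CB0' := ltW CB0. have Cg0' := ltW Cg0.
  split.
    have : r * kappa * a <= 1 / 4 * a by rewrite ler_wpM2r.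
    move=> ra; have v1 : v <= 2 * (a + b) by lra.
    have : (1 + CB) * (a + v) <= (1 + CB) * (4 * (a + b)).
      by rewrite ler_wpM2l ?addr_ge0 //; lra.
    have : 0 <= (2 + 4 * CB * Cg + Cg) * (a + b).
      by rewrite mulr_ge0 ?addr_ge0 // !mulr_ge0.
    rewrite /L; lra.
  have : CB * b <= CB * (Cg * q) by rewrite ler_wpM2l.
  have : 0 <= (1 + CB) * 4 * q by rewrite !mulr_ge0 ?addr_ge0.
  rewrite /L; lra.
Qed.

(** K^n is the sum of the image of Mi, where f is g, and of the kernel of M, on
    which the trivialisation is the identity. *)
Lemma linear_pullback_trivial n m p (f : 'rV[K]_n -> 'rV[K]_p) (c : 'rV[K]_p)
    (M : 'M[K]_(n, m)) (Mi : 'M[K]_(m, n)) (g : 'rV[K]_m -> 'rV[K]_p) :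
  Mi *m M = 1%:M -> (forall x, f x = g (x *m M)) ->
  polymap g -> proper_at g c -> regular_value g c ->
  lipschitz_trivial_value abs f c.
Proof.
move=> MiM fg g_poly gprop greg.
have [e [L [h [e0 L0 gh honto hlip]]]] := proper_trivialisation g_poly gprop greg.
pose V := [set t | nrm abs (t - c) < e].
pose rest (x : 'rV[K]_n) := x - x *m M *m Mi.
have restM x : rest x *m M = 0.
  by rewrite mulmxBl -!mulmxA MiM mulmx1 subrr.
have restB x y : rest x - rest y = (x - y) - (x - y) *m M *m Mi.
  by rewrite /rest !mulmxBl !opprD !opprK !addrA; congr (_ + _); rewrite addrAC.
pose H (u : 'rV[K]_n * 'rV[K]_p) := h (u.1 *m M) u.2 *m Mi + rest u.1.
have HM u : H u *m M = h (u.1 *m M) u.2.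
  by rewrite mulmxDl restM addr0 -mulmxA MiM mulmx1.
have rest_le x y : nrm abs (rest x - rest y) <=
    (1 + nrm abs M * nrm abs Mi) * nrm abs (x - y).
  rewrite restB; apply: le_trans (nrmB _ _) _; rewrite mulrDl mul1r lerD2l.
  rewrite -mulmxA mulrC; apply: le_trans (nrmM _ _) _.
  by rewrite ler_wpM2l // nrmM.
exists V; split; first by apply/nbhs_nrm; exists e.
exists H.
pose a := nrm abs M; pose b := nrm abs Mi.
have a0 : 0 <= a by exact: nrm_pos. have b0 : 0 <= b by exact: nrm_pos.
have fibre x : f x = c -> g (x *m M) = c by rewrite fg.
pose C1 := L * (a + 1) * b + (1 + a * b).
pose C2 := L * a * b + L * a + (1 + a * b).
have C10 : 0 < C1 by rewrite ltr_wpDl ?ltr_wpDr ?mulr_ge0 ?addr_ge0 // ltW.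
have C20 : 0 < C2.
  by rewrite ltr_wpDl ?ltr_wpDr ?addr_ge0 ?mulr_ge0 // ltW.
have up u v : f u.1 = c -> V u.2 -> f v.1 = c -> V v.2 ->
    nrm abs (H u - H v) <= C1 * (nrm abs (u.1 - v.1) + nrm abs (u.2 - v.2)).
  move=> fu Vu fv Vv; have [hu _] := hlip _ _ _ _ (fibre _ fu) (fibre _ fv) Vu Vv.
  rewrite /H opprD addrACA -mulmxBl; apply: le_trans (nrmD _ _) _.
  set x := nrm abs (u.1 - v.1) in hu *; set t := nrm abs (u.2 - v.2) in hu *.
  have x0 : 0 <= x by exact: nrm_pos. have t0 : 0 <= t by exact: nrm_pos.
  have xM : nrm abs (u.1 *m M - v.1 *m M) <= x * a.
    by rewrite -mulmxBl; exact: nrmM.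
  have h1 : nrm abs ((h (u.1 *m M) u.2 - h (v.1 *m M) v.2) *m Mi) <= L * (x * a + t) * b.
    apply: le_trans (nrmM _ _) _; rewrite ler_wpM2r //; apply: le_trans hu _.
    by rewrite ler_pM2l // lerD2r.
  have h2 := rest_le u.1 v.1; rewrite -/a -/b -/x in h2.
  apply: le_trans (lerD h1 h2) _.
  have p1 : 0 <= L * a * b * t by rewrite !mulr_ge0 // ltW.
  have p2 : 0 <= L * b * x by rewrite !mulr_ge0 // ltW.
  have p3 : 0 <= (1 + a * b) * t by rewrite mulr_ge0 // addr_ge0 // mulr_ge0.
  rewrite /C1; lra.
have down u v : f u.1 = c -> V u.2 -> f v.1 = c -> V v.2 ->
    nrm abs (u.1 - v.1) + nrm abs (u.2 - v.2) <= C2 * nrm abs (H u - H v).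
  move=> fu Vu fv Vv; have [_ hd] := hlip _ _ _ _ (fibre _ fu) (fibre _ fv) Vu Vv.
  set q := nrm abs (H u - H v).
  have q0 : 0 <= q by exact: nrm_pos.
  have hq : nrm abs (h (u.1 *m M) u.2 - h (v.1 *m M) v.2) <= q * a.
    by rewrite -!HM -mulmxBl; exact: nrmM.
  have rq : nrm abs (rest u.1 - rest v.1) <= (1 + a * b) * q.
    have restH w : rest (H w) = rest w.1.
      by rewrite {1}/rest HM /H addrAC subrr add0r.
    by rewrite -!restH; exact: rest_le.
  have xE : u.1 - v.1 = (u.1 *m M - v.1 *m M) *m Mi + (rest u.1 - rest v.1).
    by rewrite restB -mulmxBl [RHS]addrC subrK.
  have x_le : nrm abs (u.1 - v.1) <=
      nrm abs (u.1 *m M - v.1 *m M) * b + (1 + a * b) * q.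
    by rewrite {1}xE; apply: le_trans (nrmD _ _) _; rewrite lerD // nrmM.
  have hd' := le_trans hd (ler_wpM2l (ltW L0) hq).
  have xM0 := nrm_pos (u.1 *m M - v.1 *m M).
  have t0 := nrm_pos (u.2 - v.2).
  have xM : nrm abs (u.1 *m M - v.1 *m M) * b <= L * (q * a) * b.
    by rewrite ler_wpM2r //; lra.
  rewrite /C2; lra.
split.
- split=> [u [/= fu Vu]|u v|y /= Vy].
  + by rewrite /preimage /= fg HM gh //; exact: fibre.
  + rewrite !inE => -[/= fu Vu] [/= fv Vv] Huv.
    have := down u v fu Vu fv Vv; rewrite Huv subrr nrm0 mulr0 => uv.
    have := nrm_pos (u.1 - v.1); have := nrm_pos (u.2 - v.2) => t0 x0.
    have /nrm_le0/subr0_eq E1 : nrm abs (u.1 - v.1) <= 0 by lra.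
    have /nrm_le0/subr0_eq E2 : nrm abs (u.2 - v.2) <= 0 by lra.
    by rewrite (surjective_pairing u) (surjective_pairing v) E1 E2.
  + have [|x gx hx] := honto (y *m M); first by rewrite -fg.
    exists (x *m Mi + rest y, f y).
      split => //=; rewrite fg mulmxDl restM addr0 -mulmxA MiM mulmx1 //.
    have restE : rest (x *m Mi + rest y) = rest y.
      by rewrite {1}/rest mulmxDl restM addr0 -(mulmxA x) MiM mulmx1 addrAC subrr add0r.
    rewrite /H /= restE mulmxDl restM addr0 -(mulmxA x) MiM mulmx1 fg hx.
    by rewrite addrC subrK.
- have np0 : 0 <= n%:R + p%:R :> R by rewrite addr_ge0.
  have c1 : 0 <= C1 * (n%:R + p%:R) by exact: mulr_ge0 (ltW C10) np0.
  have c2 : 0 <= C2 * n%:R by exact: mulr_ge0 (ltW C20) (ler0n _ _).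
  have E0 : 0 < C1 * (n%:R + p%:R) + C2 * n%:R + 1 by lra.
  exists (C1 * (n%:R + p%:R) + C2 * n%:R + 1) => //.
  move=> u v [/= fu Vu] [/= fv Vv].
  have hup := up u v fu Vu fv Vv; have hdown := down u v fu Vu fv Vv.
  have e0' := eucl_dist_ge0 abs (H u) (H v).
  have p0 : 0 <= prod_dist abs u v by exact: sqrtr_ge0.
  apply/andP; split.
    rewrite ler_pdivrMl //.
    apply: (@le_trans _ _ (C2 * n%:R * eucl_dist abs (H u) (H v))).
      apply: le_trans (prod_dist_le abs u v) _.
      apply: le_trans (lerD (eucl_le_nrm _ _) (eucl_le_nrm _ _)) _.
      apply: le_trans hdown _; rewrite -mulrA ler_wpM2l ?(ltW C20) //.
      exact: nrm_le_eucl.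
    by rewrite ler_wpM2r //; lra.
  apply: le_trans (eucl_le_nrm _ _) _; apply: le_trans hup _.
  apply: (@le_trans _ _ (C1 * (n%:R + p%:R) * prod_dist abs u v)).
    rewrite -mulrA ler_wpM2l ?(ltW C10) // mulrDl; apply: lerD.
      by apply: le_trans (nrm_le_eucl _ _) _; rewrite ler_wpM2l // prod_dist_ge_fst.
    by apply: le_trans (nrm_le_eucl _ _) _; rewrite ler_wpM2l // prod_dist_ge_snd.
  by rewrite ler_wpM2r //; lra.
- move=> x t fx Vt; rewrite fg HM gh //; exact: fibre.
Qed.

End ProperImpliesTrivial.

Theorem mainTheorem1 (R : realType) (K : numFieldType) (abs : K -> R)
    (hK : real_or_complex abs)
    (n p m : nat) (f : 'rV[K]_n -> 'rV[K]_p) (hf : polynomial_mapping f)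
    (c : 'rV[K]_p)
    (hm : proj_dim (accum_infty (f @^-1` [set c])) = n%:Z - 1 - m%:Z) :
  lipschitz_trivial_value abs f c <->
  exists (pi : {linear 'rV[K]_n -> 'rV[K]_m}) (g : 'rV[K]_m -> 'rV[K]_p),
    [/\ forall y, exists x, pi x = y,
        polynomial_mapping g,
        regular_value g c,
        proper_at g c
      & f = g \o pi].
Proof.
have [S _] := real_or_complex_scalars hK.
have f_poly := (polymapP f).2 hf.
split.
  move=> /trivial_sections[r [L [H [r0 L0 f_lip H_sec H_onto]]]].
  have [k [A [Ai [AiA f_inv [C XC] Xk]]]] := factorisation f_poly r0 L0 f_lip.
  have dimE : proj_dim (accum_infty (f @^-1` [set c])) = n%:Z - 1 - k%:Z.
    apply: (proj_dim_accum_infty (S := S) AiA XC _ Xk).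
    by move=> x w fx wA; rewrite /= f_inv.
  have km : k = m by move: hm; rewrite dimE; lia.
  subst k; exists (mulmxr A), (fun y => f (y *m Ai)); split.
  - by move=> y; exists (y *m Ai); rewrite /= -mulmxA AiA mulmx1.
  - by apply/polymapP; exact: g_polymap.
  - exact: (g_regular f_poly r0 L0 H_sec H_onto AiA f_inv).
  - exact: (g_proper f_poly r0 L0 H_sec H_onto AiA XC).
  - by apply/funext => x; exact: (f_factor AiA f_inv).
move=> [pi [g [pi_onto /polymapP g_poly greg gprop fE]]].
have [Mi MiE] := choice (fun i : 'I_m => pi_onto (row i 1%:M)).
apply: (@linear_pullback_trivial _ _ _ S n m p f c (lin1_mx pi) (\matrix_i Mi i) g) => //.
  by apply/row_matrixP => i; rewrite row_mul rowK mul_rV_lin1 MiE.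
by move=> x; rewrite fE /= mul_rV_lin1.
Qed.
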